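(* Let $L$ be a nondegenerate homogeneous linear pencil in $g$ variables and let $\tilde L$ be a minimal dimensional defining pencil for $\mathcal B_L$. Then there is a homogeneous linear pencil $J$ (possibly with zero rows and/or zero columns) and unitaries $Q,G$ satisfying $$L=Q(\tilde L\oplus J)G^*.$$
   Context: A $d'\times d$ homogeneous linear pencil in $g$ variables is $L(x)=\sum_{j=1}^g A_jx_j$ with $A_j\in\mathbb C^{d'\times d}$. For $X=(X_1,\dots,X_g)\in(\mathbb C^{n\times n})^g$ put $L(X)=\sum_j A_j\otimes X_j$; $\|\cdot\|$ is the operator norm. $L$ is nondegenerate if for all $n$ and all $X\in(\mathbb C^{n\times n})^g$, $L(X)=0$ implies $X=0$. The pencil ball is $\mathcal B_L=(\mathcal B_L(n))_{n\in\mathbb N}$ with $\mathcal B_L(n)=\{X\in(\mathbb C^{n\times n})^g:\|L(X)\|<1\}$. A nondegenerate $p'\times p$ homogeneous linear pencil $\tilde L$ is a minimal dimensional defining pencil for a ball if every nondegenerate $d'\times d$ homogeneous linear pencil $L$ with $\mathcal B_L=\mathcal B_{\tilde L}$ satisfies $p'p\le d'd$; it is a minimal dimensional defining pencil for $\mathcal B_L$ if moreover $\mathcal B_{\tilde L}=\mathcal B_L$. The symbol $\oplus$ denotes the block-diagonal direct sum of (rectangular) matrices/pencils; here, if $L$ is $d'\times d$, then $Q\in\mathbb C^{d'\times d'}$ and $G\in\mathbb C^{d\times d}$. *)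

(* Defs.v *)
From mathcomp Require Import all_boot all_order all_algebra.
From mathcomp Require Import classical_sets reals complex mxtens.

Set Implicit Arguments.
Unset Strict Implicit.
Unset Printing Implicit Defensive.

Import GRing.Theory Num.Theory.

Local Open Scope classical_set_scope.
Local Open Scope ring_scope.
Local Open Scope complex_scope.

Definition vec_norm (R : realType) (n : nat) (v : 'cV[R[i]]_n) : R :=
  Num.sqrt (\sum_(i < n) ComplexField.Normc.normc (v i 0) ^+ 2).

Definition op_norm (R : realType) (m n : nat) (A : 'M[R[i]]_(m, n)) : R :=
  sup [set vec_norm (A *m v) | v in [set v : 'cV[R[i]]_n | vec_norm v <= 1]].

(* A homogeneous linear pencil is identified with its family of coefficients;
   pencils with no rows or no columns are allowed by the type. *)
Definition pencil (R : realType) (g d' d : nat) := 'I_g -> 'M[R[i]]_(d', d).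

Definition mxfam (R : realType) (g n : nat) := 'I_g -> 'M[R[i]]_n.

Definition pencil_eval (R : realType) (g d' d : nat) (L : pencil R g d' d)
    (n : nat) (X : mxfam R g n) : 'M[R[i]]_(d' * n, d * n) :=
  \sum_(j < g) L j *t X j.

Definition nondegenerate_pencil (R : realType) (g d' d : nat) (L : pencil R g d' d) :=
  forall (n : nat) (X : mxfam R g n),
    pencil_eval L X = 0 -> forall j : 'I_g, X j = 0.

Definition pencil_ball (R : realType) (g d' d : nat) (L : pencil R g d' d)
    (n : nat) : set (mxfam R g n) :=
  [set X | op_norm (pencil_eval L X) < 1].

Definition same_ball (R : realType) (g d' d e' e : nat)
    (L : pencil R g d' d) (M : pencil R g e' e) :=
  forall n : nat, pencil_ball L (n := n) = pencil_ball M (n := n).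

(* The competing pencils are required to have at least one row and one column.
   For g > 0 this follows from nondegeneracy; for g = 0 it excludes the empty
   pencils, which would make every minimal size 0. *)
Definition min_dim_pencil (R : realType) (g p' p : nat) (Lt : pencil R g p' p) :=
  nondegenerate_pencil Lt /\
  forall (d' d : nat) (L : pencil R g d' d),
    (0 < d')%N -> (0 < d)%N -> nondegenerate_pencil L -> same_ball L Lt ->
    (p' * p <= d' * d)%N.

Definition min_dim_defining_pencil (R : realType) (g p' p d' d : nat)
    (Lt : pencil R g p' p) (L : pencil R g d' d) :=
  min_dim_pencil Lt /\ same_ball Lt L.

Definition pencil_dsum (R : realType) (g p' p k' k : nat)
    (L : pencil R g p' p) (J : pencil R g k' k) : pencil R g (p' + k') (p + k) :=
  fun j => block_mx (L j) 0 0 (J j).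

(* castmx only transports the size of the direct sum along the two equations. *)
Definition pencil_cast (R : realType) (g m' m d' d : nat)
    (e : (m' = d') * (m = d)) (L : pencil R g m' m) : pencil R g d' d :=
  fun j => castmx e (L j).

(* Main.v *)
(* A homogeneous pencil [L] has the same ball as [Lt] iff
   |L(X)| = |Lt(X)| for all [X].  By separation from a closed cone, this makes
   [Lt_j = sum_k P_k^* L_j W_k] with [sum_k P_k^* P_k <= 1] and
   [sum_k W_k^* W_k <= 1], and likewise with [L] and [Lt] exchanged.
   Minimality forbids such a map from factoring through a proper compression of
   [Lt]; this makes the self-maps fixing [Lt] faithful, and, comparing with the
   one of maximal energy, every Schwarz inequality for such a self-map is an
   equality.  Applied to the composite [Lt -> L -> Lt], this turns the [P_k],
   [W_k] into intertwiners, [L_j W_k = P_k Lt_j] and [L_j^* P_k = W_k Lt_j^*].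
   An intertwiner of maximal rank, normalised by polar decomposition, is an
   isometry, again by minimality, and it embeds [Lt] in [L] as a direct
   summand. *)
Require Import Defs.
From mathcomp Require Import all_boot all_order all_algebra.
From mathcomp Require Import boolp classical_sets reals complex mxtens.
From mathcomp Require Import ring lra zify.
From mathcomp Require Import interval_inference topology normedtype derive.

Set Implicit Arguments.
Unset Strict Implicit.
Unset Printing Implicit Defensive.

Import Order.TTheory GRing.Theory Num.Theory.
Import numFieldNormedType.Exports.

Local Open Scope ring_scope.
Local Open Scope complex_scope.
Local Open Scope sesquilinear_scope.

(** * Matrices as a real inner product space *)

(** The obstacle to separation is that a Kraus family may have any number of members, so the cone is
    not visibly closed. Two devices remove it. A family enters only through its Gram numbers, so a
    fixed number of members suffices. And the cone consists of triples: beside [sum_k P_k^* M_j W_k]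
    it records [sum_k P_k^* P_k] and [sum_k W_k^* W_k], to be matched with [1]. Their traces bound
    every member, so a point nearest to the target exists by compactness, and the residual there is
    the separating functional. The Gram components make this a cone over the nonnegative reals only,
    hence the real inner product. The energy is built so that it cannot drop when a self-map is
    applied before the maximiser; a maximum then forces equality in all the inequalities at once,
    and no idempotent self-map has to be constructed. Minimality speaks only of sizes: it is used
    through compressions by projections, and as it bounds the product [p' * p], one application
    settles both sides. *)

Lemma sum_option (V : nmodType) (I : finType) (F : option I -> V) :
  \sum_k F k = F None + \sum_k F (Some k).
Proof.
rewrite (bigD1 None) //=; congr (_ + _).
rewrite (reindex_omap Some id) => [|[k|]] //=.
by apply: eq_bigl => k; rewrite eqxx.
Qed.

Section Adjoint.
Context {C : numClosedFieldType}.

Lemma adjmxM m n p (A : 'M[C]_(m, n)) (B : 'M[C]_(n, p)) :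
  (A *m B)^t* = B^t* *m A^t*.
Proof. by rewrite trmx_mul map_mxM. Qed.

Lemma adjmxD m n (A B : 'M[C]_(m, n)) : (A + B)^t* = A^t* + B^t*.
Proof. by rewrite linearD map_mxD. Qed.

Lemma adjmxN m n (A : 'M[C]_(m, n)) : (- A)^t* = - A^t*.
Proof. by rewrite linearN map_mxN. Qed.

Lemma adjmxB m n (A B : 'M[C]_(m, n)) : (A - B)^t* = A^t* - B^t*.
Proof. by rewrite adjmxD adjmxN. Qed.

Lemma adjmx0 m n : (0 : 'M[C]_(m, n))^t* = 0.
Proof. by rewrite trmx0 map_mx0. Qed.

Lemma adjmx1 n : (1%:M : 'M[C]_n)^t* = 1%:M.
Proof. by rewrite trmx1 map_mx1. Qed.

Lemma mulmx4 m n p q r (A : 'M[C]_(m, n)) (B : 'M[C]_(n, p))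
    (D : 'M[C]_(p, q)) (E : 'M[C]_(q, r)) :
  (A *m B) *m (D *m E) = A *m (B *m D) *m E.
Proof. by rewrite !mulmxA. Qed.

Lemma adjmx_sum m n (I : Type) (r : seq I) (P : pred I) (F : I -> 'M[C]_(m, n)) :
  (\sum_(i <- r | P i) F i)^t* = \sum_(i <- r | P i) (F i)^t*.
Proof. by apply: (big_morph (fun A => A^t*)); [exact: adjmxD | exact: adjmx0]. Qed.

Lemma adjmx_col m1 m2 n (A : 'M[C]_(m1, n)) (B : 'M[C]_(m2, n)) :
  (col_mx A B)^t* = row_mx (A^t*) (B^t*).
Proof. by rewrite tr_col_mx map_row_mx. Qed.

Lemma adjmx_row m n1 n2 (A : 'M[C]_(m, n1)) (B : 'M[C]_(m, n2)) :
  (row_mx A B)^t* = col_mx (A^t*) (B^t*).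
Proof. by rewrite tr_row_mx map_col_mx. Qed.

End Adjoint.

Section RealInnerProduct.
Variable R : realType.
Local Notation C := R[i].

Definition rdot m n (A B : 'M[C]_(m, n)) : R :=
  complex.Re (\tr (A^t* *m B)).

Definition fro2 m n (A : 'M[C]_(m, n)) : R := rdot A A.

Lemma ReD (x y : C) : complex.Re (x + y) = complex.Re x + complex.Re y.
Proof. by case: x; case: y. Qed.

Lemma ReN (x : C) : complex.Re (- x) = - complex.Re x.
Proof. by case: x. Qed.

Lemma Re_sum (I : Type) (r : seq I) (P : pred I) (F : I -> C) :
  complex.Re (\sum_(i <- r | P i) F i) = \sum_(i <- r | P i) complex.Re (F i).
Proof. by apply: (big_morph (@complex.Re R)); [exact: ReD|]. Qed.

Lemma rdotDl m n (A B D : 'M[C]_(m, n)) : rdot (A + B) D = rdot A D + rdot B D.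
Proof. by rewrite /rdot adjmxD mulmxDl mxtraceD ReD. Qed.

Lemma rdotDr m n (A B D : 'M[C]_(m, n)) : rdot D (A + B) = rdot D A + rdot D B.
Proof. by rewrite /rdot mulmxDr mxtraceD ReD. Qed.

Lemma rdotNl m n (A B : 'M[C]_(m, n)) : rdot (- A) B = - rdot A B.
Proof. by rewrite /rdot adjmxN mulNmx linearN /= ReN. Qed.

Lemma rdotNr m n (A B : 'M[C]_(m, n)) : rdot A (- B) = - rdot A B.
Proof. by rewrite /rdot mulmxN linearN /= ReN. Qed.

Lemma rdot0l m n (A : 'M[C]_(m, n)) : rdot 0 A = 0.
Proof. by rewrite /rdot adjmx0 mul0mx mxtrace0. Qed.

Lemma rdot0r m n (A : 'M[C]_(m, n)) : rdot A 0 = 0.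
Proof. by rewrite /rdot mulmx0 mxtrace0. Qed.

Lemma rdot_suml m n (I : Type) (r : seq I) (P : pred I) (F : I -> 'M[C]_(m, n)) B :
  rdot (\sum_(i <- r | P i) F i) B = \sum_(i <- r | P i) rdot (F i) B.
Proof.
by apply: (big_morph (fun A => rdot A B)) => [x y|]; rewrite ?rdotDl ?rdot0l.
Qed.

Lemma rdot_sumr m n (I : Type) (r : seq I) (P : pred I) (F : I -> 'M[C]_(m, n)) B :
  rdot B (\sum_(i <- r | P i) F i) = \sum_(i <- r | P i) rdot B (F i).
Proof.
by apply: (big_morph (fun A => rdot B A)) => [x y|]; rewrite ?rdotDr ?rdot0r.
Qed.

Lemma conjcE (x : C) : Num.conj x = x^*%C.
Proof. by []. Qed.

Lemma conjC_real (x : R) : Num.conj x%:C = x%:C.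
Proof. exact: conjc_real. Qed.

Lemma rdotE m n (A B : 'M[C]_(m, n)) :
  rdot A B = \sum_i \sum_j (complex.Re (A i j) * complex.Re (B i j)
                            + complex.Im (A i j) * complex.Im (B i j)).
Proof.
rewrite /rdot /mxtrace Re_sum exchange_big; apply: eq_bigr => j _ /=.
rewrite mxE Re_sum; apply: eq_bigr => i _; rewrite !mxE conjcE.
by case: (A i j) (B i j) => a b [c d] /=; rewrite mulNr opprK.
Qed.

Lemma rdotC m n (A B : 'M[C]_(m, n)) : rdot A B = rdot B A.
Proof.
rewrite !rdotE; apply: eq_bigr => i _; apply: eq_bigr => j _.
by rewrite mulrC [X in _ + X]mulrC.
Qed.

Lemma rdotMl m n p (P : 'M[C]_(m, n)) (A : 'M[C]_(n, p)) B :
  rdot (P *m A) B = rdot A (P^t* *m B).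
Proof. by rewrite /rdot adjmxM mulmxA. Qed.

Lemma rdotMr m n p (A : 'M[C]_(m, n)) (M : 'M[C]_(n, p)) B :
  rdot (A *m M) B = rdot A (B *m M^t*).
Proof. by rewrite /rdot adjmxM -mulmxA mxtrace_mulC mulmxA. Qed.

Lemma rdot_adj m n (A B : 'M[C]_(m, n)) : rdot (A^t*) (B^t*) = rdot A B.
Proof.
rewrite !rdotE exchange_big; apply: eq_bigr => i _; apply: eq_bigr => j _.
rewrite !mxE !conjcE.
by case: (A _ _) (B _ _) => a b [c d] /=; rewrite mulNr mulrN opprK.
Qed.

Lemma fro2_adj m n (A : 'M[C]_(m, n)) : fro2 (A^t*) = fro2 A.
Proof. exact: rdot_adj. Qed.

Lemma rdotZr m n (a : R) (A B : 'M[C]_(m, n)) : rdot A (a%:C *: B) = a * rdot A B.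
Proof.
rewrite !rdotE mulr_sumr; apply: eq_bigr => i _; rewrite mulr_sumr.
apply: eq_bigr => j _; rewrite !mxE.
by case: (A i j) (B i j) => b c [d e] /=; ring.
Qed.

Lemma rdotZl m n (a : R) (A B : 'M[C]_(m, n)) : rdot (a%:C *: A) B = a * rdot A B.
Proof. by rewrite rdotC rdotZr rdotC. Qed.

Lemma fro2Z m n (a : R) (A : 'M[C]_(m, n)) : fro2 (a%:C *: A) = a ^+ 2 * fro2 A.
Proof. by rewrite /fro2 rdotZl rdotZr mulrA. Qed.

Lemma fro2E m n (A : 'M[C]_(m, n)) :
  fro2 A = \sum_i \sum_j (complex.Re (A i j) ^+ 2 + complex.Im (A i j) ^+ 2).
Proof. exact: rdotE. Qed.

Lemma fro2_ge0 m n (A : 'M[C]_(m, n)) : 0 <= fro2 A.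
Proof.
rewrite fro2E; apply: sumr_ge0 => i _; apply: sumr_ge0 => j _.
by rewrite addr_ge0 ?sqr_ge0.
Qed.

Lemma fro2_entry m n (A : 'M[C]_(m, n)) i j :
  complex.Re (A i j) ^+ 2 + complex.Im (A i j) ^+ 2 <= fro2 A.
Proof.
rewrite fro2E (bigD1 i) //= (bigD1 j) //= -addrA lerDl addr_ge0 //.
  by apply: sumr_ge0 => k _; rewrite addr_ge0 ?sqr_ge0.
apply: sumr_ge0 => k _; apply: sumr_ge0 => l _.
by rewrite addr_ge0 ?sqr_ge0.
Qed.

Lemma fro2_le0 m n (A : 'M[C]_(m, n)) : fro2 A <= 0 -> A = 0.
Proof.
move=> A0; apply/matrixP => i j; have := fro2_entry A i j; rewrite mxE.
case: (A i j) => a b /= ab; have {A0}ab := le_trans ab A0.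
have a0 : a = 0 by nra.
have b0 : b = 0 by nra.
by rewrite a0 b0.
Qed.

Lemma fro20 m n : fro2 (0 : 'M[C]_(m, n)) = 0.
Proof. exact: rdot0l. Qed.

Lemma fro2N m n (A : 'M[C]_(m, n)) : fro2 (- A) = fro2 A.
Proof. by rewrite /fro2 rdotNl rdotNr opprK. Qed.

Lemma fro2D m n (A B : 'M[C]_(m, n)) : fro2 (A + B) = fro2 A + 2 * rdot A B + fro2 B.
Proof. by rewrite /fro2 !rdotDl !rdotDr (rdotC B A) mulr_natl mulr2n !addrA. Qed.

Lemma fro2B m n (A B : 'M[C]_(m, n)) : fro2 (A - B) = fro2 A - 2 * rdot A B + fro2 B.
Proof. by rewrite fro2D fro2N rdotNr mulrN. Qed.

Lemma rdot_le m n (A B : 'M[C]_(m, n)) : 2 * rdot A B <= fro2 A + fro2 B.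
Proof. by have := fro2_ge0 (A - B); rewrite fro2B addrAC subr_ge0. Qed.

Lemma fro2M m n p (P : 'M[C]_(m, n)) (A : 'M[C]_(n, p)) :
  fro2 (P *m A) = rdot A (P^t* *m P *m A).
Proof. by rewrite /fro2 rdotMl mulmxA. Qed.

Lemma fro2_isom m n p (V : 'M[C]_(m, n)) (A : 'M[C]_(n, p)) :
  V^t* *m V = 1%:M -> fro2 (V *m A) = fro2 A.
Proof. by move=> VV; rewrite fro2M VV mul1mx. Qed.

Lemma fro2_cols m n (A : 'M[C]_(m, n)) : fro2 A = \sum_j fro2 (col j A).
Proof.
rewrite fro2E exchange_big; apply: eq_bigr => j _; rewrite fro2E.
by apply: eq_bigr => i _; rewrite big_ord1 !mxE.
Qed.

Lemma fro2_col_mx m1 m2 n (A : 'M[C]_(m1, n)) (B : 'M[C]_(m2, n)) :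
  fro2 (col_mx A B) = fro2 A + fro2 B.
Proof.
rewrite !fro2E big_split_ord /=; congr (_ + _);
  by apply: eq_bigr => i _; apply: eq_bigr => j _; rewrite ?col_mxEu ?col_mxEd.
Qed.

Lemma psd_spectral n (s : 'M[C]_n) :
  s^t* = s -> (forall v : 'cV[C]_n, 0 <= rdot v (s *m v)) ->
  exists (U : 'M[C]_n) (d : 'I_n -> R),
    [/\ U^t* *m U = 1%:M, U *m U^t* = 1%:M, forall i, 0 <= d i &
        s = U^t* *m diag_mx (\row_i (d i)%:C) *m U].
Proof.
move=> sH s0.
have [U [D [UU UU' sE Dr]]] : exists (U : 'M[C]_n) (D : 'rV[C]_n),
    [/\ U *m U^t* = 1%:M, U^t* *m U = 1%:M, s = U^t* *m diag_mx D *m U &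
        forall i, (complex.Re (D 0 i))%:C = D 0 i].
  have sh : s \is hermsymmx by apply/is_hermitianmxP; rewrite expr0 scale1r sH.
  have Uu := spectral_unitarymx s.
  exists (spectralmx s), (spectral_diag s); split.
  - exact/unitarymxP.
  - exact/mulmx1C/unitarymxP.
  - rewrite -(invmx_unitary Uu).
    by have /orthomx_spectralP := hermitian_normalmx sh.
  - by move=> i; exact/RRe_real/(mxOverP (hermitian_spectral_diag_real sh)).
exists U, (fun i => complex.Re (D 0 i)); split=> [||i|]; [exact: UU'|exact: UU| |].
  2: have <- : D = \row_i (complex.Re (D 0 i))%:C by apply/rowP => i; rewrite mxE Dr.
  2: exact: sE.
have := s0 (U^t* *m delta_mx i 0); rewrite {1}sE.
rewrite rdotMl trmxCK !mulmxA UU mul1mx -!mulmxA (mulmxA U) UU mul1mx.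
have -> : diag_mx D *m delta_mx i 0 = D 0 i *: (delta_mx i 0 : 'cV[C]_n).
  by apply/matrixP => a b; rewrite mul_diag_mx !mxE; case: eqVneq => [->|] //=;
     rewrite !mulr0.
rewrite -Dr rdotZr; suff -> : rdot (delta_mx i 0 : 'cV[C]_n) (delta_mx i 0) = 1.
  by rewrite mulr1.
rewrite rdotE (bigD1 i) //= big_ord1 big1 ?addr0 => [|k ki].
  by rewrite !mxE !eqxx /= mulr1 mulr0 addr0.
by rewrite big_ord1 !mxE (negPf ki) /= !mulr0 addr0.
Qed.

Lemma adjmx_diag_real n (d : 'I_n -> R) :
  (diag_mx (\row_i (d i)%:C))^t* = diag_mx (\row_i (d i)%:C) :> 'M[C]_n.
Proof.
rewrite tr_diag_mx map_diag_mx; congr diag_mx; apply/rowP => i.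
by rewrite !mxE; exact: conjc_real.
Qed.

Lemma mul_diag_real n (d e : 'I_n -> R) :
  diag_mx (\row_i (d i)%:C) *m diag_mx (\row_i (e i)%:C)
  = diag_mx (\row_i (d i * e i)%:C) :> 'M[C]_n.
Proof.
apply/matrixP => i j; rewrite mul_diag_mx !mxE rmorphM /=.
by rewrite mulrnAr.
Qed.

Lemma psd_factor n (s : 'M[C]_n) :
  s^t* = s -> (forall v : 'cV[C]_n, 0 <= rdot v (s *m v)) ->
  exists Z : 'M[C]_n, Z^t* *m Z = s.
Proof.
move=> sH s0; have [U [d [UU UU' d0 ->]]] := psd_spectral sH s0.
exists (diag_mx (\row_i (Num.sqrt (d i))%:C) *m U).
rewrite adjmxM adjmx_diag_real mulmx4 mul_diag_real.
suff -> : \row_i (Num.sqrt (d i) * Num.sqrt (d i))%:C = \row_i (d i)%:C :> 'rV[C]_n.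
  by [].
by apply/rowP => i; rewrite !mxE -expr2 sqr_sqrtr.
Qed.

(** The shift by [e] makes the factor invertible even when [s] is singular. *)
Lemma pd_factor n (s : 'M[C]_n) (e : R) :
  s^t* = s -> (forall v : 'cV[C]_n, 0 <= rdot v (s *m v)) -> 0 < e ->
  exists H G : 'M[C]_n,
    [/\ H *m H^t* = s + e%:C%:M, G *m H = 1%:M & H *m G = 1%:M].
Proof.
move=> sH s0 e0; have [U [d [UU UU' d0 ->]]] := psd_spectral sH s0.
pose f i := Num.sqrt (d i + e).
have fP i : 0 < d i + e by rewrite ltr_wpDl.
exists (U^t* *m diag_mx (\row_i (f i)%:C)), (diag_mx (\row_i (f i)^-1%:C) *m U).
have diag_id (h : 'I_n -> R) : (forall i, h i = 1) ->
    diag_mx (\row_i (h i)%:C) = 1%:M :> 'M[C]_n.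
  by move=> h1; apply/matrixP => i j; rewrite !mxE h1.
split.
- rewrite adjmxM trmxCK adjmx_diag_real mulmx4 mul_diag_real.
  have -> : e%:C%:M = U^t* *m (diag_mx (\row_i e%:C)) *m U :> 'M[C]_n.
    have -> : diag_mx (\row_i e%:C) = e%:C%:M :> 'M[C]_n.
      by apply/matrixP => i j; rewrite !mxE.
    by rewrite scalar_mxC -mulmxA UU mulmx1.
  rewrite -mulmxDl -mulmxDr -raddfD /=.
  suff -> : \row_i (f i * f i)%:C = \row_i (d i)%:C + \row_i e%:C :> 'rV[C]_n.
    by [].
  by apply/rowP => i; rewrite !mxE -rmorphD /= -expr2 sqr_sqrtr // ltW.
- rewrite mulmxA -(mulmxA _ U) UU' mulmx1 mul_diag_real diag_id // => i.
  by rewrite mulVf // sqrtr_eq0 -ltNge.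
- rewrite mulmx4 mul_diag_real diag_id ?mulmx1 // => i.
  by rewrite mulfV // sqrtr_eq0 -ltNge.
Qed.

Lemma orthonormal_row_basis m n (H : 'M[C]_(m, n)) :
  exists (k : nat) (B : 'M[C]_(k, n)) (M : 'M[C]_(m, k)) (M' : 'M[C]_(k, m)),
    [/\ B *m B^t* = 1%:M, H = M *m B & B = M' *m H].
Proof.
have BE : (schmidt (row_base H) :=: H)%MS.
  exact: (eqmx_trans (eqmx_schmidt_free (row_base_free H)) (eq_row_base H)).
have /submxP[M HM] : (H <= schmidt (row_base H))%MS by rewrite BE.
have /submxP[M' BM] : (schmidt (row_base H) <= H)%MS by rewrite BE.
exists (\rank H), (schmidt (row_base H)), M, M'; split => //.
by apply/unitarymxP/schmidt_unitarymx; exact: rank_leq_col.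
Qed.

(** For an orthonormal row basis [B] of [E], both [E B^* B = E] and [B E = B] hold; the adjoint of
    the second turns the first into [E = B^* B]. *)
Lemma proj_factor n (E : 'M[C]_n) :
  E^t* = E -> E *m E = E ->
  exists (k : nat) (V : 'M[C]_(n, k)), V^t* *m V = 1%:M /\ V *m V^t* = E.
Proof.
move=> EH EE; have [k [B [M [M' [Bu EM BM]]]]] := orthonormal_row_basis E.
exists k, (B^t*); rewrite trmxCK; split => //.
have EB : E *m B^t* *m B = E by rewrite {1}EM -(mulmxA M) Bu mulmx1.
have BEB : B *m E = B by rewrite {1}BM -mulmxA EE.
by rewrite -[in RHS]EB -{1}BEB adjmxM EH.
Qed.

Lemma isometry_dim m n (V : 'M[C]_(m, n)) : V^t* *m V = 1%:M -> (n <= m)%N.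
Proof.
move=> /(congr1 mxrank); rewrite mxrank1 => <-.
exact: leq_trans (mxrankM_maxr _ _) (rank_leq_row _).
Qed.

Lemma isometry_full n k (V : 'M[C]_(n, k)) : V^t* *m V = 1%:M -> k = n -> V *m V^t* = 1%:M.
Proof. by move=> VV kn; case: _ / kn in V VV *; exact: mulmx1C. Qed.

Lemma fro2_coisom m n p (V : 'M[C]_(m, n)) (A : 'M[C]_(m, p)) :
  V^t* *m V = 1%:M -> fro2 (V^t* *m A) <= fro2 A.
Proof.
move=> VV; have := fro2_ge0 (A - V *m (V^t* *m A)).
have AVA : rdot A (V *m (V^t* *m A)) = fro2 (V^t* *m A).
  by rewrite rdotC rdotMl.
by rewrite fro2B fro2_isom // AVA mulr_natl mulr2n opprD addrA subrK subr_ge0.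
Qed.

End RealInnerProduct.

(** * Kraus families and the Schwarz inequality with defect *)

Section Kraus.
Variable R : realType.
Local Notation C := R[i].

Definition subunital (I : finType) a b (P : I -> 'M[C]_(a, b)) :=
  forall v : 'cV[C]_b, \sum_k fro2 (P k *m v) <= fro2 v.

(** With both families subunital this is a completely contractive map carrying [L] to [N]. *)
Definition kraus_map (I : finType) g a' a b' b
    (P : I -> 'M[C]_(a', b')) (W : I -> 'M[C]_(a, b))
    (L : pencil R g a' a) (N : pencil R g b' b) :=
  forall j, \sum_k (P k)^t* *m L j *m W k = N j.

Lemma subunital_mx (I : finType) a b m (P : I -> 'M[C]_(a, b)) (M : 'M[C]_(b, m)) :
  subunital P -> \sum_k fro2 (P k *m M) <= fro2 M.
Proof.
move=> Psub; under eq_bigr do rewrite fro2_cols.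
rewrite exchange_big fro2_cols; apply: ler_sum => j _ /=.
by under eq_bigr do rewrite colE -mulmxA -colE; exact: Psub.
Qed.

Lemma subunital_comp (I J : finType) a b c
    (P : I -> 'M[C]_(a, b)) (Q : J -> 'M[C]_(b, c)) :
  subunital P -> subunital Q ->
  subunital (fun x : I * J => P x.1 *m Q x.2).
Proof.
move=> Ps Qs v; apply: le_trans (Qs v).
rewrite -(pair_bigA _ (fun i j => fro2 (P i *m Q j *m v))) exchange_big /=.
apply: ler_sum => j _; apply: le_trans (Ps (Q j *m v)).
by under eq_bigr do rewrite -mulmxA.
Qed.

Lemma kraus_map_comp (I J : finType) g a' a b' b c' c
    (P : I -> 'M[C]_(a', b')) (W : I -> 'M[C]_(a, b))
    (P2 : J -> 'M[C]_(b', c')) (W2 : J -> 'M[C]_(b, c))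
    (L : pencil R g a' a) (M : pencil R g b' b) (N : pencil R g c' c) :
  kraus_map P W L M -> kraus_map P2 W2 M N ->
  kraus_map (fun x : I * J => P x.1 *m P2 x.2) (fun x => W x.1 *m W2 x.2) L N.
Proof.
move=> k1 k2 j.
rewrite -(pair_bigA _ (fun x y => (P x *m P2 y)^t* *m L j *m (W x *m W2 y))).
rewrite exchange_big /= -k2; apply: eq_bigr => y _.
rewrite -k1 mulmx_sumr mulmx_suml; apply: eq_bigr => x _.
by rewrite adjmxM !mulmxA.
Qed.

Definition adj_pencil g a' a (L : pencil R g a' a) : pencil R g a a' :=
  fun j => (L j)^t*.

Lemma kraus_map_adj (I : finType) g a' a b' b
    (P : I -> 'M[C]_(a', b')) (W : I -> 'M[C]_(a, b))
    (L : pencil R g a' a) (N : pencil R g b' b) :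
  kraus_map P W L N -> kraus_map W P (adj_pencil L) (adj_pencil N).
Proof.
move=> k j; rewrite /adj_pencil -k adjmx_sum; apply: eq_bigr => x _.
by rewrite !adjmxM trmxCK mulmxA.
Qed.

Lemma subunital_defect (I : finType) a b (P : I -> 'M[C]_(a, b)) :
  subunital P ->
  exists Z : 'M[C]_b, Z^t* *m Z = 1%:M - \sum_k (P k)^t* *m P k.
Proof.
move=> Psub; apply: psd_factor => [|v].
  rewrite adjmxB adjmx1 adjmx_sum; congr (_ - _); apply: eq_bigr => k _.
  by rewrite adjmxM trmxCK.
rewrite mulmxBl mul1mx rdotDr rdotNr mulmx_suml rdot_sumr subr_ge0.
by under eq_bigr do rewrite -fro2M; exact: Psub.
Qed.

Lemma fro2_defect (I : finType) a b m (P : I -> 'M[C]_(a, b)) (Z : 'M[C]_b)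
    (M : 'M[C]_(b, m)) :
  Z^t* *m Z = 1%:M - \sum_k (P k)^t* *m P k ->
  fro2 (Z *m M) = fro2 M - \sum_k fro2 (P k *m M).
Proof.
move=> ZZ; rewrite fro2M ZZ mulmxBl mul1mx rdotDr rdotNr mulmx_suml rdot_sumr.
by congr (_ - _); apply: eq_bigr => k _; rewrite fro2M.
Qed.

(** Expand the squares: the cross terms add up to [|B v|^2] by the Kraus formula, and the terms
    [|P_k B v|^2] to at most that. *)
Lemma kraus_schwarz (I : finType) a' a b' b m
    (P : I -> 'M[C]_(a', b')) (W : I -> 'M[C]_(a, b))
    (A : 'M[C]_(a', a)) (B : 'M[C]_(b', b)) (v : 'M[C]_(b, m)) :
  subunital P -> \sum_k (P k)^t* *m A *m W k = B ->
  \sum_k fro2 ((A *m W k - P k *m B) *m v) + fro2 (B *m v)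
    <= \sum_k fro2 (A *m W k *m v).
Proof.
move=> Psub AB; have PB := subunital_mx (B *m v) Psub.
have cross : \sum_k rdot (A *m W k *m v) (P k *m (B *m v)) = fro2 (B *m v).
  rewrite /fro2 -{3}AB mulmx_suml rdot_sumr; apply: eq_bigr => k _.
  by rewrite rdotC rdotMl !mulmxA.
have -> : \sum_k fro2 ((A *m W k - P k *m B) *m v)
    = \sum_k fro2 (A *m W k *m v) - 2 * fro2 (B *m v) + \sum_k fro2 (P k *m (B *m v)).
  rewrite -cross mulr_sumr -sumrN -!big_split; apply: eq_bigr => k _ /=.
  by rewrite mulmxBl fro2B -(mulmxA (P k)).
move: PB; move: (fro2 (B *m v)) (\sum_k _) (\sum_k _) => x y z; lra.
Qed.

End Kraus.

(** * Gram reduction and compactness *)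

Section Gram.
Variable R : realType.
Local Notation C := R[i].

(** The Gram matrix of any family is positive semidefinite of size [E], so it has a square factor,
    whose rows form the reduced family. *)
Lemma gram_reduce (I E : finType) (f : I -> E -> C) :
  exists g : E -> E -> C, forall a b,
    \sum_i Num.conj (f i a) * f i b = \sum_e Num.conj (g e a) * g e b.
Proof.
pose F : 'M[C]_(#|I|, #|E|) := \matrix_(i, e) f (enum_val i) (enum_val e).
have [|v|Z ZE] := @psd_factor R _ (F^t* *m F).
- by rewrite adjmxM trmxCK.
- by rewrite -fro2M; exact: fro2_ge0.
exists (fun e a => Z (enum_rank e) (enum_rank a)) => a b.
have /matrixP/(_ (enum_rank a) (enum_rank b)) := ZE; rewrite !mxE => ZEab.
rewrite (reindex (fun k : 'I_#|I| => enum_val k)) /=; last first.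
  by exists (fun x => enum_rank x) => x _; rewrite ?enum_valK ?enum_rankK.
rewrite [RHS](reindex (fun k : 'I_#|E| => enum_val k)) /=; last first.
  by exists (fun x => enum_rank x) => x _; rewrite ?enum_valK ?enum_rankK.
transitivity (\sum_j F^t* (enum_rank a) j * F j (enum_rank b)).
  by apply: eq_bigr => k _; rewrite !mxE !enum_rankK.
by rewrite -ZEab; apply: eq_bigr => k _; rewrite !mxE enum_valK.
Qed.

Lemma sesquilinear_sumE (I : finType) m n p q
    (F : I -> 'M[C]_(m, n)) (G : I -> 'M[C]_(p, q)) (X : 'M[C]_(m, p)) i j :
  (\sum_k (F k)^t* *m X *m G k) i j
  = \sum_u \sum_v X v u * \sum_k Num.conj (F k v i) * G k u j.
Proof.
rewrite summxE; under eq_bigr do rewrite mxE.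
rewrite exchange_big; apply: eq_bigr => u _ /=.
under eq_bigr do rewrite mxE mulr_suml.
rewrite exchange_big; apply: eq_bigr => v _ /=.
rewrite mulr_sumr; apply: eq_bigr => k _; rewrite !mxE.
by rewrite mulrAC mulrC.
Qed.

End Gram.

(* The entries of a pair [(P, W)]; it also indexes families of such pairs, since
   by [gram_reduce] a family needs no more members than a pair has entries. *)
Definition kraus_ix a' a b' b : finType := (('I_a' * 'I_b') + ('I_a * 'I_b))%type.

Section KrausParam.
Variable R : realType.
Local Notation C := R[i].
Variables a' a b' b : nat.
Local Notation E := (kraus_ix a' a b' b).

Definition krausP (f : E -> C) : 'M[C]_(a', b') := \matrix_(i, j) f (inl (i, j)).
Definition krausW (f : E -> C) : 'M[C]_(a, b) := \matrix_(i, j) f (inr (i, j)).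

(** The entries of [P] and [W] are gathered in one vector so that the mixed Gram numbers survive as
    well; by [sesquilinear_sumE] nothing else enters the sums. *)
Lemma kraus_reduce (I : finType) (P : I -> 'M[C]_(a', b')) (W : I -> 'M[C]_(a, b)) :
  exists g : E -> E -> C,
    [/\ forall X, \sum_k (krausP (g k))^t* *m X *m krausW (g k)
                  = \sum_k (P k)^t* *m X *m W k,
        forall X, \sum_k (krausP (g k))^t* *m X *m krausP (g k)
                  = \sum_k (P k)^t* *m X *m P k &
        forall X, \sum_k (krausW (g k))^t* *m X *m krausW (g k)
                  = \sum_k (W k)^t* *m X *m W k].
Proof.
have [g gE] := gram_reduce (fun k (e : E) =>
  match e with inl ij => P k ij.1 ij.2 | inr ij => W k ij.1 ij.2 end).
exists g; split=> X; apply/matrixP => i j; rewrite !sesquilinear_sumE;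
  apply: eq_bigr => u _; apply: eq_bigr => v _; congr (_ * _).
- have /= -> := gE (inl (v, i)) (inr (u, j)).
  by apply: eq_bigr => k _; rewrite !mxE.
- have /= -> := gE (inl (v, i)) (inl (u, j)).
  by apply: eq_bigr => k _; rewrite !mxE.
- have /= -> := gE (inr (v, i)) (inr (u, j)).
  by apply: eq_bigr => k _; rewrite !mxE.
Qed.

End KrausParam.

Section Compactness.
Variable R : realType.
Local Notation C := R[i].
Local Open Scope classical_set_scope.

(** Tychonoff makes the box compact. The conditions may be infinite in number: later they range over
    all test vectors. *)
Lemma box_min (T : eqType) (J : Type) (M : R)
    (c : J -> prod_topology (fun _ : T => R : topologicalType) -> R)
    (F : prod_topology (fun _ : T => R : topologicalType) -> R) :
  (forall j, continuous (c j)) -> continuous F ->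
  (exists t, (forall x, `|t x| <= M) /\ forall j, c j t <= 0) ->
  exists t, [/\ forall x, `|t x| <= M, forall j, c j t <= 0 &
    forall t', (forall x, `|t' x| <= M) -> (forall j, c j t' <= 0) -> F t <= F t'].
Proof.
move=> cc cF [t0 [t0M t0c]].
pose X := prod_topology (fun _ : T => R : topologicalType).
pose A : set X := [set t | forall x, `[- M, M]%classic (t x)] `&`
  [set t | forall j, c j t <= 0].
have boxE (t : X) : (forall x, `|t x| <= M) <-> (forall x, `[- M, M]%classic (t x)).
  split=> h x; first by rewrite /= in_itv /= -ler_norml.
  by rewrite ler_norml; have := h x; rewrite /= in_itv /=.
have cA : compact A.
  apply: compact_closedI.
    by apply: (@tychonoff T (fun=> R) (fun=> `[- M, M]%classic)) => _; exact: segment_compact.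
  have -> : [set t | forall j, c j t <= 0] = \bigcap_j [set t : X | c j t <= 0].
    by apply/seteqP; split=> t /= h j; [move=> _|]; exact: h.
  apply: closed_bigI => j _.
  by apply: (@closed_comp _ _ (c j) [set x | x <= 0]) => [t _|]; [exact: cc|exact: closed_le].
have A0 : A !=set0 by exists t0; split => //; exact/boxE.
have [t tA tmin] := compact_EVT_min A0 cA (continuous_subspaceT cF).
have [/boxE tM tc] : A t by rewrite inE in tA.
exists t; split => // t' /boxE t'M t'c; apply: tmin.
by rewrite inE.
Qed.

End Compactness.

Section ContinuousMatrix.
Variables (R : realType) (X : topologicalType).
Local Notation C := R[i].

Definition ccont (f : X -> C) :=
  continuous (fun t => complex.Re (f t) : R) /\ continuous (fun t => complex.Im (f t) : R).

Definition mxcont m n (F : X -> 'M[C]_(m, n)) := forall i j, ccont (fun t => F t i j).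

Lemma eq_continuous (f g : X -> R) : f =1 g -> continuous f -> continuous g.
Proof. by move=> /funext ->. Qed.

Lemma eq_ccont (f g : X -> C) : f =1 g -> ccont f -> ccont g.
Proof. by move=> /funext ->. Qed.

Lemma continuous_addr (f g : X -> R) :
  continuous f -> continuous g -> continuous (fun t => f t + g t).
Proof. by move=> cf cg t; apply: cvgD; [exact: cf|exact: cg]. Qed.

Lemma continuous_oppr (f : X -> R) : continuous f -> continuous (fun t => - f t).
Proof. by move=> cf t; apply: cvgN; exact: cf. Qed.

Lemma continuous_cstr (x : R) : continuous (fun _ : X => x).
Proof. exact: cst_continuous. Qed.

Lemma continuous_sumr (I : finType) (f : I -> X -> R) :
  (forall i, continuous (f i)) -> continuous (fun t => \sum_i f i t).
Proof.
move=> cf; elim: (index_enum I) => [|i s IH].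
  by apply: (@eq_continuous (fun=> 0)) => [t|]; [rewrite big_nil|exact: cst_continuous].
apply: (@eq_continuous (fun t => f i t + \sum_(j <- s) f j t)) => [t|].
  by rewrite big_cons.
by move=> t; apply: cvgD; [exact: cf|exact: IH].
Qed.

Lemma ccont_cst z : ccont (fun=> z).
Proof. by split; exact: cst_continuous. Qed.

Lemma ccontD f g : ccont f -> ccont g -> ccont (fun t => f t + g t).
Proof.
move=> [fr fi] [gr gi]; split.
- apply: (@eq_continuous (fun t => complex.Re (f t) + complex.Re (g t))) => [t|t].
    by rewrite ReD.
  by apply: cvgD; [exact: fr|exact: gr].
- apply: (@eq_continuous (fun t => complex.Im (f t) + complex.Im (g t))) => [t|t].
    by case: (f t) (g t) => ? ? [].
  by apply: cvgD; [exact: fi|exact: gi].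
Qed.

Lemma ccontM f g : ccont f -> ccont g -> ccont (fun t => f t * g t).
Proof.
move=> [fr fi] [gr gi]; split.
- apply: (@eq_continuous (fun t => complex.Re (f t) * complex.Re (g t)
            - complex.Im (f t) * complex.Im (g t))) => [t|t].
    by case: (f t) (g t) => ? ? [].
  by apply: cvgB; apply: cvgM; [exact: fr|exact: gr|exact: fi|exact: gi].
- apply: (@eq_continuous (fun t => complex.Re (f t) * complex.Im (g t)
            + complex.Im (f t) * complex.Re (g t))) => [t|t].
    by case: (f t) (g t) => ? ? [].
  by apply: cvgD; apply: cvgM; [exact: fr|exact: gi|exact: fi|exact: gr].
Qed.

Lemma ccont_conj f : ccont f -> ccont (fun t => Num.conj (f t)).
Proof.
move=> [fr fi]; split.
- by apply: (eq_continuous _ fr) => t; case: (f t).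
- apply: (@eq_continuous (fun t => - complex.Im (f t))) => [t|t]; first by case: (f t).
  by apply: cvgN; exact: fi.
Qed.

Lemma ccont_sum (I : finType) (f : I -> X -> C) :
  (forall i, ccont (f i)) -> ccont (fun t => \sum_i f i t).
Proof.
move=> cf; elim: (index_enum I) => [|i s IH].
  by under eq_fun do rewrite big_nil; exact: ccont_cst.
by under eq_fun do rewrite big_cons; exact: ccontD.
Qed.

Lemma mxcont_cst m n (A : 'M[C]_(m, n)) : mxcont (fun=> A).
Proof. by move=> i j; exact: ccont_cst. Qed.

Lemma mxcontM m n p (F : X -> 'M[C]_(m, n)) (G : X -> 'M[C]_(n, p)) :
  mxcont F -> mxcont G -> mxcont (fun t => F t *m G t).
Proof.
move=> cF cG i j; under eq_fun do rewrite mxE.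
by apply: ccont_sum => k; apply: ccontM; [exact: cF|exact: cG].
Qed.

Lemma mxcontB m n (F G : X -> 'M[C]_(m, n)) :
  mxcont F -> mxcont G -> mxcont (fun t => F t - G t).
Proof.
move=> cF cG i j; under eq_fun do rewrite !mxE -mulN1r.
by apply: ccontD; [exact: cF|apply: ccontM; [exact: ccont_cst|exact: cG]].
Qed.

Lemma mxcont_adj m n (F : X -> 'M[C]_(m, n)) :
  mxcont F -> mxcont (fun t => (F t)^t*).
Proof.
by move=> cF i j; under eq_fun do rewrite !mxE; apply: ccont_conj; exact: cF.
Qed.

Lemma mxcont_sum m n (I : finType) (F : I -> X -> 'M[C]_(m, n)) :
  (forall i, mxcont (F i)) -> mxcont (fun t => \sum_i F i t).
Proof.
by move=> cF i j; under eq_fun do rewrite summxE; apply: ccont_sum => k; exact: cF.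
Qed.

Lemma continuous_fro2 m n (F : X -> 'M[C]_(m, n)) :
  mxcont F -> continuous (fun t => fro2 (F t)).
Proof.
move=> cF; rewrite /fro2 /rdot /mxtrace.
have [] // : ccont (fun t => \sum_i ((F t)^t* *m F t) i i).
by apply: ccont_sum => i; apply: mxcontM => //; exact: mxcont_adj.
Qed.

End ContinuousMatrix.

Section KrausTopology.
Variables (R : realType) (a' a b' b : nat).
Local Notation C := R[i].
Local Notation E := (kraus_ix a' a b' b).
Local Notation T := ((E * E) * bool)%type.
Local Notation X := (prod_topology (fun _ : T => R : topologicalType)).

Definition kraus_of (t : T -> R) (k e : E) : C := t (k, e, false) +i* t (k, e, true).

Lemma kraus_ofK (g : E -> E -> C) :
  exists t, kraus_of t = g.
Proof.
exists (fun x => (if x.2 then @complex.Im R else @complex.Re R) (g x.1.1 x.1.2)).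
by apply/funext => k; apply/funext => e; rewrite /kraus_of /=; case: (g k e).
Qed.

Lemma kraus_of_cont k e : ccont (fun t : X => kraus_of t k e).
Proof. by split=> /=; exact: (@proj_continuous T (fun=> R)). Qed.

Lemma krausP_cont k : mxcont (fun t : X => krausP (kraus_of t k)).
Proof.
move=> i j; apply: (eq_ccont _ (kraus_of_cont k (inl (i, j)))) => t.
by rewrite mxE.
Qed.

Lemma krausW_cont k : mxcont (fun t : X => krausW (kraus_of t k)).
Proof.
move=> i j; apply: (eq_ccont _ (kraus_of_cont k (inr (i, j)))) => t.
by rewrite mxE.
Qed.

Lemma kraus_of_bound (t : T -> R) (M : R) :
  0 <= M ->
  (forall k, fro2 (krausP (kraus_of t k)) <= M ^+ 2) ->
  (forall k, fro2 (krausW (kraus_of t k)) <= M ^+ 2) ->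
  forall x, `|t x| <= M.
Proof.
move=> M0 PM WM [[k e] c].
have : t (k, e, false) ^+ 2 + t (k, e, true) ^+ 2 <= M ^+ 2.
  case: e => [] [i j].
    by have := le_trans (fro2_entry (krausP (kraus_of t k)) i j) (PM k); rewrite !mxE.
  by have := le_trans (fro2_entry (krausW (kraus_of t k)) i j) (WM k); rewrite !mxE.
move=> h; rewrite -(ger0_norm M0) -ler_sqr ?nnegrE // !real_normK ?num_real //.
by apply: le_trans h; case: c; rewrite ?lerDl ?lerDr sqr_ge0.
Qed.

End KrausTopology.

(** * Operator norms of pencils *)

Section OperatorNorm.
Variable R : realType.
Local Notation C := R[i].

Lemma vec_normE n (v : 'cV[C]_n) : vec_norm v = Num.sqrt (fro2 v).
Proof.
rewrite /vec_norm fro2E; congr Num.sqrt; apply: eq_bigr => i _.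
rewrite big_ord1; case: (v i 0) => a b /=.
by rewrite sqr_sqrtr // addr_ge0 ?sqr_ge0.
Qed.

Lemma fro2_sum_le (I : finType) m n (F : I -> 'M[C]_(m, n)) :
  fro2 (\sum_i F i) <= #|I|%:R * \sum_i fro2 (F i).
Proof.
have h : 2 * fro2 (\sum_i F i) <= \sum_i \sum_j (fro2 (F i) + fro2 (F j)).
  rewrite /fro2 rdot_suml mulr_sumr; apply: ler_sum => i _.
  by rewrite rdot_sumr mulr_sumr; apply: ler_sum => j _; exact: rdot_le.
rewrite -(ler_pM2l (ltr0n R 2)) (le_trans h) //.
set S := \sum_i fro2 (F i); set k := #|I|.
have -> : \sum_i \sum_j (fro2 (F i) + fro2 (F j)) = S *+ k + S *+ k.
  transitivity (\sum_i (fro2 (F i) *+ k + S)).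
    by apply: eq_bigr => i _; rewrite big_split /= sumr_const.
  by rewrite big_split /= sumrMnl sumr_const.
by rewrite -mulr2n -[S *+ k]mulr_natl -[_ *+ 2]mulr_natl.
Qed.

Lemma fro2_scale (z : C) m n (A : 'M[C]_(m, n)) :
  fro2 (z *: A) = (complex.Re z ^+ 2 + complex.Im z ^+ 2) * fro2 A.
Proof.
rewrite !fro2E mulr_sumr; apply: eq_bigr => i _; rewrite mulr_sumr.
apply: eq_bigr => j _; rewrite mxE; case: z (A i j) => a b [c d] /=; ring.
Qed.

Lemma fro2_mul_le m n (A : 'M[C]_(m, n)) :
  exists K, forall v : 'cV[C]_n, fro2 (A *m v) <= K * fro2 v.
Proof.
exists (n%:R * \sum_j fro2 (col j A)) => v.
have -> : A *m v = \sum_j v j 0 *: col j A.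
  apply/colP => i; rewrite mxE summxE; apply: eq_bigr => j _.
  by rewrite !mxE mulrC.
apply: (le_trans (fro2_sum_le _)); rewrite card_ord -mulrA ler_wpM2l ?ler0n //.
rewrite mulr_suml; apply: ler_sum => j _; rewrite fro2_scale mulrC.
by rewrite ler_wpM2l ?fro2_ge0 // fro2_entry.
Qed.

Local Open Scope classical_set_scope.

(** The supremum in [op_norm] means something only for a bounded set; any crude bound on [A v] will
    do. *)
Lemma op_norm_has_sup m n (A : 'M[C]_(m, n)) :
  has_sup [set vec_norm (A *m v) | v in [set v : 'cV[C]_n | vec_norm v <= 1]].
Proof.
split.
  by exists (vec_norm (A *m 0)), 0 => //=; rewrite vec_normE fro20 sqrtr0 ler01.
have [K KA] := fro2_mul_le A.
exists (Num.sqrt `|K|) => _ [v /= v1 <-]; rewrite vec_normE.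
apply: ler_wsqrtr; apply: (le_trans (KA v)).
have v1' : fro2 v <= 1 by move: v1; rewrite vec_normE -{1}sqrtr1 ler_sqrt.
apply: (le_trans (ler_wpM2r (fro2_ge0 v) (ler_norm K))).
by rewrite -[X in _ <= X]mulr1 ler_wpM2l.
Qed.

Lemma op_norm_ge0 m n (A : 'M[C]_(m, n)) : 0 <= op_norm A.
Proof.
apply: (@le_trans _ _ (vec_norm (A *m 0))).
  by rewrite vec_normE sqrtr_ge0.
apply: sup_upper_bound; first exact: op_norm_has_sup.
by exists 0 => //=; rewrite vec_normE fro20 sqrtr0 ler01.
Qed.

Lemma op_norm_bound m n (A : 'M[C]_(m, n)) (v : 'cV[C]_n) :
  fro2 (A *m v) <= op_norm A ^+ 2 * fro2 v.
Proof.
have [v0|v0] := leP (fro2 v) 0.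
  by rewrite (fro2_le0 v0) mulmx0 !fro20 mulr0.
pose r := (Num.sqrt (fro2 v))^-1.
have r0 : 0 < r by rewrite invr_gt0 sqrtr_gt0.
have rv : r ^+ 2 * fro2 v = 1 by rewrite exprVn sqr_sqrtr ?ltW // mulVf ?gt_eqF.
have h : vec_norm (A *m (r%:C *: v)) <= op_norm A.
  apply: sup_upper_bound; first exact: op_norm_has_sup.
  by exists (r%:C *: v) => //=; rewrite vec_normE fro2Z rv sqrtr1.
move: h; rewrite vec_normE -scalemxAr fro2Z => h.
rewrite -(@ler_pM2l _ (r ^+ 2)) ?exprn_gt0 // mulrCA rv mulr1.
rewrite -(@ler_sqrt _ _ (op_norm A ^+ 2)) ?sqr_ge0 //.
by rewrite sqrtr_sqr (ger0_norm (op_norm_ge0 A)).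
Qed.

Lemma op_norm_le m n (A : 'M[C]_(m, n)) (c : R) :
  0 <= c -> (forall v : 'cV[C]_n, fro2 (A *m v) <= c ^+ 2 * fro2 v) ->
  op_norm A <= c.
Proof.
move=> c0 Ac; apply: ge_sup; first by case: (op_norm_has_sup A).
move=> _ [v /= v1 <-]; have v1' : fro2 v <= 1 by move: v1; rewrite vec_normE -{1}sqrtr1 ler_sqrt.
rewrite vec_normE -(ger0_norm c0) -sqrtr_sqr; apply: ler_wsqrtr.
by apply: (le_trans (Ac v)); rewrite -[X in _ <= X]mulr1 ler_wpM2l ?sqr_ge0.
Qed.

End OperatorNorm.

(** * Tensor action of pencils and transfer of bounds *)

Section PencilAction.
Variable R : realType.
Local Notation C := R[i].

(* [pencil_eval L X] acts on [C^a (x) C^n], identified with a x n matrices, by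
   [W |-> sum_j L_j W X_j^T]; here [X] stands for the transposes and may be
   rectangular. *)
Definition pact g a' a m n (L : pencil R g a' a) (X : 'I_g -> 'M[C]_(m, n))
    (W : 'M[C]_(a, m)) : 'M[C]_(a', n) := \sum_j L j *m W *m X j.

(** Here [c] bounds the square of the norm, and [c = 0] expresses vanishing. *)
Definition bounded_at g a' a m n (L : pencil R g a' a)
    (X : 'I_g -> 'M[C]_(m, n)) (c : R) :=
  forall W, fro2 (pact L X W) <= c * fro2 W.

Definition mx2vec a n (W : 'M[C]_(a, n)) : 'cV[C]_(a * n) :=
  \col_k W (mxtens_unindex k).1 (mxtens_unindex k).2.

Definition vec2mx a n (v : 'cV[C]_(a * n)) : 'M[C]_(a, n) :=
  \matrix_(i, j) v (mxtens_index (i, j)) 0.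

Lemma vec2mxK a n (v : 'cV[C]_(a * n)) : mx2vec (vec2mx v) = v.
Proof.
by apply/colP => k; rewrite !mxE -surjective_pairing mxtens_unindexK.
Qed.

Lemma sum_mxtens a n (F : 'I_(a * n) -> R) :
  \sum_k F k = \sum_i \sum_j F (mxtens_index (i, j)).
Proof.
rewrite pair_bigA (reindex (@mxtens_index a n)) /=.
  by apply: eq_bigr => -[].
exists (@mxtens_unindex a n) => x _; [exact: mxtens_indexK|exact: mxtens_unindexK].
Qed.

Lemma fro2_mx2vec a n (W : 'M[C]_(a, n)) : fro2 (mx2vec W) = fro2 W.
Proof.
rewrite !fro2E sum_mxtens; apply: eq_bigr => i _; apply: eq_bigr => j _.
by rewrite big_ord1 !mxE mxtens_indexK.
Qed.

Lemma tensmx_mx2vec a' a m n (A : 'M[C]_(a', a)) (X : 'M[C]_(m, n)) W :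
  (A *t X) *m mx2vec W = mx2vec (A *m W *m X^T).
Proof.
apply/colP => k; rewrite -(mxtens_unindexK k) !mxE mxtens_indexK.
case: (mxtens_unindex k) => i j /=.
transitivity (\sum_u \sum_v A i u * X j v * W u v).
  rewrite pair_bigA (reindex (@mxtens_index a n)) /=.
    by apply: eq_bigr => -[u v] _; rewrite tensmxE !mxE mxtens_indexK.
  by exists (@mxtens_unindex a n) => x _; [exact: mxtens_indexK|exact: mxtens_unindexK].
rewrite exchange_big; apply: eq_bigr => v _; rewrite !mxE mulr_suml.
by apply: eq_bigr => u _; rewrite mulrAC.
Qed.

Lemma pencil_eval_mx2vec g a' a n (L : pencil R g a' a) (X : mxfam R g n) W :
  pencil_eval L X *m mx2vec W = mx2vec (pact L (fun j => (X j)^T) W).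
Proof.
rewrite /pencil_eval mulmx_suml /pact.
transitivity (\sum_j mx2vec (L j *m W *m (X j)^T)).
  by apply: eq_bigr => j _; exact: tensmx_mx2vec.
apply/esym/(big_morph (@mx2vec a' n)) => [x y|]; by apply/colP => k; rewrite !mxE.
Qed.

Lemma bounded_op_norm g a' a n (L : pencil R g a' a) (X : mxfam R g n) (c : R) :
  0 <= c -> bounded_at L (fun j => (X j)^T) (c ^+ 2) ->
  op_norm (pencil_eval L X) <= c.
Proof.
move=> c0 Lc; apply: op_norm_le => // v.
by rewrite -(vec2mxK v) pencil_eval_mx2vec !fro2_mx2vec.
Qed.

Lemma op_norm_bounded g a' a n (L : pencil R g a' a) (X : mxfam R g n) :
  bounded_at L (fun j => (X j)^T) (op_norm (pencil_eval L X) ^+ 2).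
Proof.
move=> W; have := op_norm_bound (pencil_eval L X) (mx2vec W).
by rewrite pencil_eval_mx2vec !fro2_mx2vec.
Qed.

Lemma pactZ g a' a m n (L : pencil R g a' a) (X : 'I_g -> 'M[C]_(m, n)) z W :
  pact L (fun j => z *: X j) W = z *: pact L X W.
Proof.
by rewrite /pact scaler_sumr; apply: eq_bigr => j _; rewrite -scalemxAr.
Qed.

Lemma pact_mul g a' a m n p q (L : pencil R g a' a) (X : 'I_g -> 'M[C]_(m, n))
    (E : 'M[C]_(p, m)) (F : 'M[C]_(n, q)) W :
  pact L (fun j => E *m X j *m F) W = pact L X (W *m E) *m F.
Proof.
by rewrite /pact mulmx_suml; apply: eq_bigr => j _; rewrite !mulmxA.
Qed.

(** A ball only decides whether a norm is [< 1]. Scaling [X] by [(c + f)^(-1/2)] puts it strictly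
    inside the first ball, hence inside the second; then [f] tends to zero. *)
Lemma same_ball_bounded_square g a' a b' b n
    (L : pencil R g a' a) (M : pencil R g b' b) (X : 'I_g -> 'M[C]_n) (c : R) :
  same_ball L M -> 0 <= c -> bounded_at L X c -> bounded_at M X c.
Proof.
move=> LM c0 Lc W; apply/ler_addgt0Pr => e e0.
(* With this [f] the surplus [f * fro2 W] is at most [e]; the [+ 1] covers [W = 0]. *)
pose f := e / (fro2 W + 1); have W0 := fro2_ge0 W.
have f0 : 0 < f by rewrite divr_gt0 // ltr_wpDl.
have cf : 0 < c + f by rewrite ltr_wpDl.
pose r := (Num.sqrt (c + f))^-1.
have r2 : r ^+ 2 = (c + f)^-1 by rewrite exprVn sqr_sqrtr // ltW.
pose Y : mxfam R g n := fun j => (r%:C *: X j)^T.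
have YE : (fun j => (Y j)^T) = (fun j => r%:C *: X j).
  by apply/funext => j; rewrite trmxK.
have : pencil_ball L Y.
  rewrite /pencil_ball /=; pose s := Num.sqrt (c / (c + f)).
  have s2 : s ^+ 2 = c / (c + f) by rewrite sqr_sqrtr // divr_ge0 // ltW.
  apply: (@le_lt_trans _ _ s); last first.
    by rewrite -sqrtr1 ltr_sqrt // ltr_pdivrMr // mul1r ltrDl.
  apply: bounded_op_norm; first exact: sqrtr_ge0.
  rewrite YE => V; rewrite pactZ fro2Z r2 s2 mulrAC [X in _ <= X]mulrC.
  by rewrite ler_wpM2l // invr_ge0 ltW.
rewrite LM /pencil_ball /= => MY.
have := op_norm_bounded M Y W; rewrite YE pactZ fro2Z r2 => MW.
have {MW}MW : fro2 (pact M X W) <= (c + f) * fro2 W.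
  rewrite -(@ler_pM2l _ (c + f)^-1) ?invr_gt0 // mulKf ?gt_eqF //.
  apply: (le_trans MW); rewrite -[X in _ <= X]mul1r ler_wpM2r //.
  by rewrite expr_le1 // ?op_norm_ge0 // ltW.
apply: (le_trans MW); rewrite mulrDl lerD2l /f mulrAC ler_pdivrMr ?ltr_wpDl //.
by rewrite ler_wpM2l ?ltW // ltrDl.
Qed.

(** A rectangular [X] sits as the corner block [E X F] of a square matrix with the same bound.
    Separation later produces such an [X]. *)
Lemma same_ball_bounded g a' a b' b m n
    (L : pencil R g a' a) (M : pencil R g b' b) (X : 'I_g -> 'M[C]_(m, n)) (c : R) :
  same_ball L M -> 0 <= c -> bounded_at L X c -> bounded_at M X c.
Proof.
move=> LM c0 Lc.
pose E : 'M[C]_(m + n, m) := col_mx 1%:M 0.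
pose F : 'M[C]_(n, m + n) := row_mx 0 1%:M.
have EE : E^t* *m E = 1%:M.
  by rewrite adjmx_col mul_row_col adjmx0 adjmx1 mul1mx mulmx0 addr0.
have FF : F *m F^t* = 1%:M.
  by rewrite adjmx_row mul_row_col adjmx0 adjmx1 mul1mx mul0mx add0r.
have froF k (Y : 'M[C]_(k, n)) : fro2 (Y *m F) = fro2 Y.
  by rewrite /fro2 rdotMr -mulmxA FF mulmx1.
have froE k (Y : 'M[C]_(k, m + n)) : fro2 (Y *m E) <= fro2 Y.
  rewrite -[in X in _ <= X](hsubmxK Y) -[in X in X <= _](hsubmxK Y).
  rewrite mul_row_col mulmx1 mulmx0 addr0 -[X in _ <= X]fro2_adj adjmx_row.
  by rewrite fro2_col_mx !fro2_adj lerDl fro2_ge0.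
have : bounded_at M (fun j => E *m X j *m F) c.
  apply: (same_ball_bounded_square LM c0) => W; rewrite pact_mul froF.
  by apply: (le_trans (Lc _)); rewrite ler_wpM2l.
move=> Mc W; have := Mc (W *m E^t*).
by rewrite pact_mul froF -mulmxA EE mulmx1 [fro2 (_ *m E^t*)]/fro2 rdotMr trmxCK -mulmxA EE mulmx1.
Qed.

Lemma bounded_same_ball g a' a b' b (L : pencil R g a' a) (M : pencil R g b' b) :
  (forall n (X : 'I_g -> 'M[C]_n) c, 0 <= c ->
     bounded_at L X c <-> bounded_at M X c) ->
  same_ball L M.
Proof.
move=> LM n; apply/seteqP; split=> X; rewrite /pencil_ball /=;
  apply: le_lt_trans; apply: bounded_op_norm; rewrite ?op_norm_ge0 //;
  apply/LM; rewrite ?sqr_ge0 //; exact: op_norm_bounded.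
Qed.

Lemma nondegenerate_bounded g a' a (L : pencil R g a' a) :
  nondegenerate_pencil L <->
  forall n (X : 'I_g -> 'M[C]_n), bounded_at L X 0 -> forall j, X j = 0.
Proof.
split=> [Ln n X LX j|Ln n X LX j].
  suff /Ln/(_ j)/(congr1 trmx) : pencil_eval L (fun j => (X j)^T) = 0.
    by rewrite trmxK trmx0.
  apply/matrixP => k l; rewrite mxE.
  transitivity ((pencil_eval L (fun j => (X j)^T) *m delta_mx l (0 : 'I_1)) k 0).
    by rewrite -colE mxE.
  rewrite -(vec2mxK (delta_mx l 0)) pencil_eval_mx2vec.
  have -> : (fun j => (X j)^T^T) = X by apply/funext => i; rewrite trmxK.
  have := LX (vec2mx (delta_mx l 0)); rewrite mul0r => /fro2_le0 ->.
  by rewrite !mxE.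
suff /(_ n (fun j => (X j)^T))/(_ _ j)/(congr1 trmx) :
    forall n (X : 'I_g -> 'M[C]_n), bounded_at L X 0 -> forall j, X j = 0.
  rewrite trmxK trmx0; apply=> W; rewrite mul0r -fro2_mx2vec -pencil_eval_mx2vec.
  by rewrite LX mul0mx fro20.
exact: Ln.
Qed.

End PencilAction.

(** * Separation from the cone of completely contractive images *)

Section Cone.
Variable R : realType.
Local Notation C := R[i].

(** The first-order condition at a minimum. For negative [x] the chosen [e] is below [1] and
    satisfies [e |K| <= -x], which makes [2 x + e K] negative. *)
Lemma quadratic_ge0 (x K : R) :
  (forall e, 0 < e -> e < 1 -> 0 <= 2 * e * x + e ^+ 2 * K) -> 0 <= x.
Proof.
move=> h; rewrite leNgt; apply/negP => x0.
pose e := (- x) / (`|K| + - x + 1).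
have K0 := normr_ge0 K; have KK := ler_norm K.
have d0 : 0 < `|K| + - x + 1 by lra.
have e0 : 0 < e by rewrite divr_gt0 // oppr_gt0.
have e1 : e < 1 by rewrite ltr_pdivrMr // mul1r; lra.
have eK : e * K <= - x.
  apply: (@le_trans _ _ (e * `|K|)); first by rewrite ler_wpM2l // ltW.
  rewrite /e mulrAC ler_pdivrMr // ler_wpM2l //; lra.
have := h _ e0 e1.
have -> : 2 * e * x + e ^+ 2 * K = e * (2 * x + e * K) by ring.
by rewrite pmulr_rge0 //; lra.
Qed.

Variables (g b' b : nat).

(** The ambient space of the cone, whose points are the triples [kpencil P W], [kgram P],
    [kgram W]. *)
Definition tri_dot (B Y : pencil R g b' b) (S S' : 'M[C]_b') (T T' : 'M[C]_b) : R :=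
  \sum_j rdot (B j) (Y j) + rdot S S' + rdot T T'.

Definition tri_sq (B : pencil R g b' b) (S : 'M[C]_b') (T : 'M[C]_b) : R :=
  tri_dot B B S S T T.

Lemma tri_sq_expand (B Y : pencil R g b' b) (S S' : 'M[C]_b') (T T' : 'M[C]_b) (e : R) :
  tri_sq (fun j => B j + e%:C *: Y j) (S + e%:C *: S') (T + e%:C *: T')
  = tri_sq B S T + (2 * e * tri_dot B Y S S' T T' + e ^+ 2 * tri_sq Y S' T').
Proof.
have h m n (X Z : 'M[C]_(m, n)) : rdot (X + e%:C *: Z) (X + e%:C *: Z)
    = rdot X X + (2 * e * rdot X Z + e ^+ 2 * rdot Z Z).
  by rewrite -[LHS]/(fro2 _) fro2D rdotZr fro2Z -addrA mulrA.
rewrite /tri_sq /tri_dot (eq_bigr _ (fun j _ => h _ _ (B j) (Y j))) !h.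
rewrite !big_split /= -!mulr_sumr.
have alg (x y z u v w p q r : R) :
  x + (2 * e * y + e ^+ 2 * z) + (u + (2 * e * v + e ^+ 2 * w))
    + (p + (2 * e * q + e ^+ 2 * r))
  = x + u + p + (2 * e * (y + v + q) + e ^+ 2 * (z + w + r)) by ring.
exact: alg.
Qed.

Lemma tri_sq_ge0 (B : pencil R g b' b) S T : 0 <= tri_sq B S T.
Proof.
by rewrite /tri_sq /tri_dot !addr_ge0 ?fro2_ge0 //; apply: sumr_ge0 => j _; exact: fro2_ge0.
Qed.

Lemma tri_sq_le (B : pencil R g b' b) S T :
  [/\ forall j, fro2 (B j) <= tri_sq B S T, fro2 S <= tri_sq B S T
    & fro2 T <= tri_sq B S T].
Proof.
have S0 := fro2_ge0 S; have T0 := fro2_ge0 T.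
have B0 : 0 <= \sum_j fro2 (B j) by apply: sumr_ge0 => j _; exact: fro2_ge0.
split => [j||].
- rewrite /tri_sq /tri_dot (bigD1 j) //= -!addrA lerDl !addr_ge0 //.
  by apply: sumr_ge0 => i _; exact: fro2_ge0.
- by rewrite /tri_sq /tri_dot -/(fro2 S) -/(fro2 T) addrAC lerDr addr_ge0.
- by rewrite /tri_sq /tri_dot -/(fro2 S) -/(fro2 T) lerDr addr_ge0.
Qed.

Variables (a' a : nat) (M : pencil R g a' a) (N : pencil R g b' b).

Definition kpencil (I : finType) (P : I -> 'M[C]_(a', b')) (W : I -> 'M[C]_(a, b)) :
  pencil R g b' b := fun j => \sum_k (P k)^t* *m M j *m W k.

Definition kgram (I : finType) m n (P : I -> 'M[C]_(m, n)) : 'M[C]_n :=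
  \sum_k (P k)^t* *m P k.

Definition kraus_dist (I : finType) (P : I -> 'M[C]_(a', b')) (W : I -> 'M[C]_(a, b)) : R :=
  tri_sq (fun j => N j - kpencil P W j) (1%:M - kgram P) (1%:M - kgram W).

Lemma rdot1_gram (I : finType) m n (P : I -> 'M[C]_(m, n)) :
  rdot 1%:M (kgram P) = \sum_k fro2 (P k).
Proof.
rewrite rdot_sumr; apply: eq_bigr => k _; apply: esym.
by have := fro2M (P k) 1%:M; rewrite !mulmx1.
Qed.

(** Coercivity: a member is bounded by the trace of the Gram sum, and that trace by the distance of
    the Gram sum from [1]. *)
Lemma gram_bound (I : finType) m n (P : I -> 'M[C]_(m, n)) k :
  fro2 (P k) <= 2 * fro2 (1%:M : 'M[C]_n) + fro2 (1%:M - kgram P).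
Proof.
have : fro2 (P k) <= rdot 1%:M (kgram P).
  rewrite rdot1_gram (bigD1 k) //= lerDl; apply: sumr_ge0 => i _; exact: fro2_ge0.
have := rdot_le (- 1%:M) (1%:M - kgram P); have := fro2_ge0 (1%:M - kgram P).
have := fro2_ge0 (1%:M : 'M[C]_n).
rewrite fro2N rdotNl rdotDr rdotNr -/(fro2 _).
move: (fro2 (P k)) (fro2 1%:M) (fro2 (_ - _)) (rdot _ _) => x y z w; lra.
Qed.

Lemma kraus_dist_bound (I : finType) (P : I -> 'M[C]_(a', b')) (W : I -> 'M[C]_(a, b)) :
  (forall k, fro2 (P k) <= 2 * fro2 (1%:M : 'M[C]_b') + kraus_dist P W) /\
  (forall k, fro2 (W k) <= 2 * fro2 (1%:M : 'M[C]_b) + kraus_dist P W).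
Proof.
have [_ hP hW] := tri_sq_le (fun j => N j - kpencil P W j) (1%:M - kgram P) (1%:M - kgram W).
by split=> k; apply: le_trans (gram_bound _ k) _; rewrite lerD2l.
Qed.

(** Coercivity confines the relevant families to a box, where a minimum exists; [kraus_reduce] then
    compares it with families over any index type. *)
Lemma kraus_dist_min : exists g0 : kraus_ix a' a b' b -> kraus_ix a' a b' b -> C,
  forall (I : finType) (P : I -> 'M[C]_(a', b')) (W : I -> 'M[C]_(a, b)),
    kraus_dist (fun k => krausP (g0 k)) (fun k => krausW (g0 k)) <= kraus_dist P W.
Proof.
pose X := prod_topology (fun _ : (kraus_ix a' a b' b * kraus_ix a' a b' b) * bool
  => R : topologicalType).
pose F (t : X) := kraus_dist (fun k => krausP (kraus_of t k))
  (fun k => krausW (kraus_of t k)).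
have cF : continuous F.
  rewrite /F.
  have cP := @krausP_cont R a' a b' b; have cW := @krausW_cont R a' a b' b.
  have cS (I : finType) m n (Q : I -> X -> 'M[C]_(m, n)) : (forall k, mxcont (Q k)) ->
      continuous (fun t => fro2 (1%:M - kgram (Q ^~ t))).
    move=> cQ; apply: continuous_fro2; apply: mxcontB; first exact: mxcont_cst.
    by apply: mxcont_sum => k; apply: mxcontM => //; exact: mxcont_adj.
  have cB : continuous (fun t : X => \sum_j fro2 (N j - kpencil
      (fun k => krausP (kraus_of t k)) (fun k => krausW (kraus_of t k)) j)).
    apply: (@continuous_sumr R X _ (fun j t => fro2 (N j - kpencil
      (fun k => krausP (kraus_of t k)) (fun k => krausW (kraus_of t k)) j))) => j.
    apply: continuous_fro2; apply: mxcontB; first exact: mxcont_cst.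
    apply: mxcont_sum => k; apply: mxcontM => //; apply: mxcontM; last exact: mxcont_cst.
    exact: mxcont_adj.
  have c2 := cS _ _ _ (fun k t => krausP (kraus_of t k)) cP.
  have c3 := cS _ _ _ (fun k t => krausW (kraus_of t k)) cW.
  exact: (continuous_addr (continuous_addr cB c2) c3).
have FE t : F t = kraus_dist (fun k => krausP (kraus_of t k))
  (fun k => krausW (kraus_of t k)) by [].
have F0 t : 0 <= F t by exact: tri_sq_ge0.
have FP t k : fro2 (krausP (kraus_of t k)) <= 2 * fro2 (1%:M : 'M[C]_b') + F t.
  by have [h _] := kraus_dist_bound (fun k => krausP (kraus_of t k)) (fun k => krausW (kraus_of t k)).
have FW t k : fro2 (krausW (kraus_of t k)) <= 2 * fro2 (1%:M : 'M[C]_b) + F t.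
  by have [_ h] := kraus_dist_bound (fun k => krausP (kraus_of t k)) (fun k => krausW (kraus_of t k)).
clearbody F.
(* [D0] is the value at the zero family; a competitor above it cannot beat the minimum over the
   box. *)
have [D0 D0E] : exists D, D = F (fun=> 0) by eexists.
have [B [BB B0 BP BW]] : exists B, [/\ B <= B ^+ 2, 0 <= B,
    2 * fro2 (1%:M : 'M[C]_b') + D0 <= B & 2 * fro2 (1%:M : 'M[C]_b) + D0 <= B].
  have D00 : 0 <= D0 by rewrite D0E.
  move: (fro2_ge0 (1%:M : 'M[C]_b')) (fro2_ge0 (1%:M : 'M[C]_b)).
  move: (fro2 _) (fro2 _) => x y x0 y0; exists (2 * x + 2 * y + D0 + 1).
  by split; [rewrite expr2; apply: ler_peMl| | |]; lra.
have inbox (t : X) : F t <= D0 -> forall x, `|t x| <= B.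
  move=> FD; apply: kraus_of_bound => // k; apply: le_trans BB.
    by apply: le_trans BP; rewrite (le_trans (FP t k)) // lerD2l.
  by apply: le_trans BW; rewrite (le_trans (FW t k)) // lerD2l.
have [||t [tB _ tmin]] := @box_min R _ void B (fun _ _ => 0) F _ cF.
- by case.
- by exists (fun=> 0); split => [|[]] //; apply: (inbox (fun=> 0)); rewrite D0E.
have {}tmin (t' : X) : F t <= F t'.
  have [le|lt] := leP (F t') D0; first by apply: tmin => [|[]] //; exact: inbox.
  apply: le_trans (ltW lt); rewrite D0E; apply: tmin => [|[]] //.
  by apply: (inbox (fun=> 0)); rewrite D0E.
exists (kraus_of t) => I P W.
have [f [fPW fP fW]] := kraus_reduce P W.
have [t' t'f] := kraus_ofK f; have := tmin t'; rewrite !FE t'f.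
have gE m n (J : finType) (Q : J -> 'M[C]_(m, n)) :
    kgram Q = \sum_k (Q k)^t* *m 1%:M *m Q k.
  by apply: eq_bigr => k _; rewrite mulmx1.
have hP : kgram (fun k => krausP (f k)) = kgram P by rewrite [LHS]gE fP -gE.
have hW : kgram (fun k => krausW (f k)) = kgram W by rewrite [LHS]gE fW -gE.
have hK : kpencil (fun k => krausP (f k)) (fun k => krausW (f k)) = kpencil P W.
  by apply/funext => j; exact: fPW.
by rewrite /kraus_dist hP hW hK.
Qed.

End Cone.

Section Separation.
Variable R : realType.
Local Notation C := R[i].
Variables (g a' a b' b : nat) (M : pencil R g a' a) (N : pencil R g b' b).

(** If the distance from [(N, 1, 1)] to the cone is not zero, the residual at the nearest point
    separates: moving from that point towards a generator cannot reduce the distance, which gives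
    the sign on generators, and rescaling the point gives the sign on the target. *)
Lemma kraus_separation :
  (exists (I : finType) (P : I -> 'M[C]_(a', b')) (W : I -> 'M[C]_(a, b)),
     [/\ kraus_map P W M N, kgram P = 1%:M & kgram W = 1%:M])
  \/ (exists (B : pencil R g b' b) (S : 'M[C]_b') (T : 'M[C]_b),
     [/\ S^t* = S, T^t* = T,
       forall P W, tri_dot B (fun j => P^t* *m M j *m W) S (P^t* *m P) T (W^t* *m W) <= 0 &
       0 < tri_dot B N S 1%:M T 1%:M]).
Proof.
have [g0 g0min] := kraus_dist_min M N.
pose P0 k := krausP (g0 k); pose W0 k := krausW (g0 k).
have {}g0min (I : finType) (P : I -> 'M[C]_(a', b')) (W : I -> 'M[C]_(a, b)) :
  kraus_dist M N P0 W0 <= kraus_dist M N P W by exact: g0min.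
pose B j := N j - kpencil M P0 W0 j.
pose S := 1%:M - kgram P0; pose T := 1%:M - kgram W0.
have gramH (I : finType) m n (Q : I -> 'M[C]_(m, n)) : (1%:M - kgram Q)^t* = 1%:M - kgram Q.
  rewrite adjmxB adjmx1 adjmx_sum; congr (_ - _); apply: eq_bigr => k _.
  by rewrite adjmxM trmxCK.
have [D0|D0] := leP (tri_sq B S T) 0.
  left; exists (kraus_ix a' a b' b), P0, W0; have [h1 h2 h3] := tri_sq_le B S T.
  split.
  - move=> j; apply/esym/eqP; rewrite -subr_eq0; apply/eqP/fro2_le0.
    exact: le_trans (h1 j) D0.
  - by apply/esym/eqP; rewrite -subr_eq0; apply/eqP/fro2_le0; exact: le_trans D0.
  - by apply/esym/eqP; rewrite -subr_eq0; apply/eqP/fro2_le0; exact: le_trans D0.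
right; exists B, S, T; split; [exact: gramH|exact: gramH| |].
  move=> P W; rewrite -oppr_ge0.
  apply: (@quadratic_ge0 _ _ (tri_sq (fun j => P^t* *m M j *m W) (P^t* *m P) (W^t* *m W))).
  move=> e e0 e1.
  (* Adjoining [P] and [W] with weight [sqrt e] adds [e] times the generator to all three components
     of the nearest point. *)
  pose r := Num.sqrt e; have r2 : Num.conj r%:C * r%:C = e%:C.
    by rewrite conjC_real -rmorphM /= -expr2 sqr_sqrtr // ltW.
  pose P1 k := if k is Some x then P0 x else r%:C *: P.
  pose W1 k := if k is Some x then W0 x else r%:C *: W.
  have opt (I : finType) m n (F : option I -> 'M[C]_(m, n)) :
      \sum_k F k = F None + \sum_k F (Some k).
    exact: sum_option.
  have scl m n p q (X : 'M[C]_(m, n)) (Y : 'M[C]_(m, p)) (Z : 'M[C]_(p, q)) :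
      (r%:C *: X)^t* *m Y *m (r%:C *: Z) = e%:C *: (X^t* *m Y *m Z).
    by rewrite -scalemxAr linearZ /= map_mxZ -!scalemxAl scalerA [_ * _]mulrC r2.
  have scl1 m n (X : 'M[C]_(m, n)) :
      (r%:C *: X)^t* *m (r%:C *: X) = e%:C *: (X^t* *m X).
    by have := scl _ _ _ _ X 1%:M X; rewrite !mulmx1.
  have := g0min _ P1 W1; rewrite /kraus_dist.
  have -> : (fun j => N j - kpencil M P1 W1 j)
      = (fun j => B j + (- e)%:C *: (P^t* *m M j *m W)).
    apply/funext => j; rewrite /kpencil opt /= scl /B opprD addrCA addrC.
    by rewrite rmorphN scaleNr.
  have -> : 1%:M - kgram P1 = S + (- e)%:C *: (P^t* *m P).
    by rewrite /kgram opt /= scl1 /S opprD addrCA addrC rmorphN scaleNr.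
  have -> : 1%:M - kgram W1 = T + (- e)%:C *: (W^t* *m W).
    by rewrite /kgram opt /= scl1 /T opprD addrCA addrC rmorphN scaleNr.
  rewrite tri_sq_expand -/S -/T -/B lerDl sqrrN.
  by rewrite mulrN mulNr mulrN.
(* The target is the residual plus the nearest point, so it remains to see that these two do not
   pair negatively. *)
have -> : tri_dot B N S 1%:M T 1%:M
    = tri_sq B S T + tri_dot B (kpencil M P0 W0) S (kgram P0) T (kgram W0).
  have rs m n (X Y Z : 'M[C]_(m, n)) : Z = X + Y -> rdot X Z = rdot X X + rdot X Y.
    by move=> ->; rewrite rdotDr.
  rewrite /tri_sq /tri_dot (rs _ _ S (kgram P0)) ?subrK //.
  rewrite (rs _ _ T (kgram W0)) ?subrK //.
  rewrite (eq_bigr _ (fun j _ => rs _ _ (B j) (kpencil M P0 W0 j) (N j) _)) => [|j].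
    have alg (x y z u v w : R) : x + y + (z + u) + (v + w) = x + z + v + (y + u + w).
      ring.
    by rewrite big_split /=; exact: alg.
  by rewrite subrK.
apply: ltr_wpDr => //.
apply: (@quadratic_ge0 _ _ (tri_sq (kpencil M P0 W0) (kgram P0) (kgram W0))) => e e0 e1.
(* The nearest point times [1 - e] is still in the cone. *)
pose r := Num.sqrt (1 - e).
have r2 : Num.conj r%:C * r%:C = 1 - e%:C.
  rewrite conjC_real -rmorphM /= -expr2 sqr_sqrtr ?rmorphB ?rmorph1 //.
  by rewrite subr_ge0 ltW.
have scl (I : finType) m n p q (X : I -> 'M[C]_(m, n)) (Y : 'M[C]_(m, p)) (Z : I -> 'M[C]_(p, q)) :
    \sum_k (r%:C *: X k)^t* *m Y *m (r%:C *: Z k) = (1 - e%:C) *: \sum_k ((X k)^t* *m Y *m Z k).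
  rewrite scaler_sumr; apply: eq_bigr => k _.
  by rewrite -scalemxAr linearZ /= map_mxZ -!scalemxAl scalerA [_ * _]mulrC r2.
have scl1 (I : finType) m n (X : I -> 'M[C]_(m, n)) :
    kgram (fun k => r%:C *: X k) = (1 - e%:C) *: kgram X.
  have := scl _ _ _ _ _ X 1%:M X; rewrite /kgram.
  by under eq_bigr do rewrite mulmx1; under [in RHS]eq_bigr do rewrite mulmx1.
have := g0min _ (fun k => r%:C *: P0 k) (fun k => r%:C *: W0 k); rewrite /kraus_dist !scl1.
have -> : (fun j => N j - kpencil M (fun k => r%:C *: P0 k) (fun k => r%:C *: W0 k) j)
    = (fun j => B j + e%:C *: kpencil M P0 W0 j).
  apply/funext => j; rewrite {1}/kpencil scl scalerBl scale1r /B.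
  by rewrite opprB addrCA addrC.
have e1E n (Z : 'M[C]_n) : 1%:M - (1 - e%:C) *: Z = (1%:M - Z) + e%:C *: Z.
  by rewrite scalerBl scale1r opprB addrCA addrC.
by rewrite !e1E tri_sq_expand -/S -/T -/B lerDl.
Qed.

End Separation.

(** * Kraus form of maps that preserve bounds *)

Section Factorization.
Variable R : realType.
Local Notation C := R[i].

Lemma block_compression a' a b' b k' k (A : 'M[C]_(a', a))
    (P : 'M[C]_(a' + k', b')) (W : 'M[C]_(a + k, b)) :
  P^t* *m block_mx A 0 0 (0 : 'M[C]_(k', k)) *m W
  = (usubmx P)^t* *m A *m usubmx W.
Proof.
rewrite -{1}(vsubmxK P) -{1}(vsubmxK W) adjmx_col mul_row_block !mulmx0 !addr0.
by rewrite mul_row_col mul0mx addr0.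
Qed.

Lemma fro2_gram m n (A : 'M[C]_(m, n)) : fro2 A = rdot 1%:M (A^t* *m A).
Proof. by have := fro2M A 1%:M; rewrite !mulmx1. Qed.

Lemma rdot_mulr_adj m n p (X : 'M[C]_(m, n)) (Y : 'M[C]_(m, p)) (Z : 'M[C]_(p, n)) :
  rdot X (Y *m Z) = rdot (X *m Z^t*) Y.
Proof. by rewrite rdotMr trmxCK. Qed.

(** Otherwise the separating functional becomes a tuple [X] contradicting the hypothesis: [S] and
    [T] are negative, and after a small shift the factors [H] of [-S] and [K] of [-T] normalise [B]
    to [X_j = K^-1 B_j^* (H^-1)^*]. *)
Theorem bounded_factorization g a' a b' b (L : pencil R g a' a) (N : pencil R g b' b) :
  (forall m n (X : 'I_g -> 'M[C]_(m, n)) c, 0 <= c -> bounded_at L X c -> bounded_at N X c) ->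
  exists (I : finType) (P : I -> 'M[C]_(a', b')) (W : I -> 'M[C]_(a, b)),
    [/\ kraus_map P W L N, subunital P & subunital W].
Proof.
move=> LN.
(* The zero summand takes up the slack in [sum_k P_k^* P_k <= 1]. *)
pose M : pencil R g (a' + 1) (a + 1) := fun j => block_mx (L j) 0 0 0.
case: (kraus_separation M N) => [[I [P [W [PW P1 W1]]]]|[B [S [T [SH TH le0 gt0]]]]].
  have sub m n (F : I -> 'M[C]_(m + 1, n)) : kgram F = 1%:M ->
      subunital (fun k => usubmx (F k)).
    move=> F1 v; rewrite [X in _ <= X](_ : _ = \sum_k fro2 (F k *m v)).
      apply: ler_sum => k _; rewrite -{2}(vsubmxK (F k)) mul_col_mx fro2_col_mx.
      by rewrite lerDl fro2_ge0.
    under eq_bigr do rewrite fro2M.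
    by rewrite -rdot_sumr -mulmx_suml -/(kgram F) F1 mul1mx.
  exists I, (fun k => usubmx (P k)), (fun k => usubmx (W k)).
  split; [|exact: sub|exact: sub] => j.
  by rewrite -PW; apply: eq_bigr => k _; rewrite block_compression.
exfalso.
have neg_psd n (U : 'M[C]_n) : (forall Q : 'M[C]_(1, n), rdot U (Q^t* *m Q) <= 0) ->
    forall v : 'cV[C]_n, 0 <= rdot v (- U *m v).
  move=> U0 v; rewrite mulNmx rdotNr oppr_ge0; have := U0 (v^t*).
  by rewrite trmxCK rdot_mulr_adj trmxCK rdotC.
(* Testing on the zero summand alone isolates [S], and [T] below. *)
have S0 : forall v : 'cV[C]_b', 0 <= rdot v (- S *m v).
  apply: neg_psd => Q; have := le0 (col_mx 0 Q) 0.
  rewrite /tri_dot big1 => [|j _]; last by rewrite mulmx0 rdot0r.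
  rewrite mulmx0 rdot0r addr0 add0r adjmx_col mul_row_col adjmx0 mul0mx add0r.
  by [].
have T0 : forall v : 'cV[C]_b, 0 <= rdot v (- T *m v).
  apply: neg_psd => Q; have := le0 0 (col_mx 0 Q).
  rewrite /tri_dot big1 => [|j _]; last by rewrite adjmx0 !mul0mx rdot0r.
  rewrite mulmx0 rdot0r !add0r adjmx_col mul_row_col adjmx0 mul0mx add0r.
  by [].
pose D := tri_dot B N S 1%:M T 1%:M.
have small (x f : R) : 0 < x -> 0 <= f -> exists e, 0 < e /\ e * f < x.
  move=> x0 f0; exists (x / (f + 1)); have f1 : 0 < f + 1 by rewrite ltr_wpDl.
  by split; [rewrite divr_gt0 | rewrite mulrAC ltr_pdivrMr // mulrDr mulr1 ltrDl].
(* The shift by [e] has to cost less than the separation gap [D]. *)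
have [e [e0 ef]] := small D _ gt0 (addr_ge0 (fro2_ge0 (1%:M : 'M[C]_b')) (fro2_ge0 (1%:M : 'M[C]_b))).
have [|H [Hi [HH HiH HHi]]] := @pd_factor R _ (- S) e _ S0 e0.
  by rewrite adjmxN SH.
have [|K [Ki [KK KiK KKi]]] := @pd_factor R _ (- T) e _ T0 e0.
  by rewrite adjmxN TH.
have le_fac m n (U F : 'M[C]_n) (Q : 'M[C]_(m, n)) : F *m F^t* = - U + e%:C%:M ->
    - rdot U (Q^t* *m Q) <= fro2 (Q *m F).
  move=> FF; rewrite -[X in _ <= X]fro2_adj adjmxM fro2M trmxCK FF mulmxDl mulNmx.
  rewrite mul_scalar_mx rdotDr rdotNr rdotZr (rdot_mulr_adj (Q^t*)) trmxCK [rdot _ U]rdotC lerDl.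
  by rewrite mulr_ge0 ?fro2_ge0 // ltW.
pose X j := Ki *m (B j)^t* *m Hi^t*.
(* Testing [le0] at [t Y H^-1] and [W1 K^-1] gives [(t - t^2) |Y|^2 <= |W1|^2]; the best choice
   [t = 1/2] yields the constant [4]. *)
have LX : bounded_at L X 4.
  move=> W1; set Y := pact L X W1.
  have := le0 (col_mx ((2^-1)%:C *: Y *m Hi) 0) (col_mx (W1 *m Ki) 0).
  rewrite /tri_dot.
  under eq_bigr do rewrite block_compression !col_mxKu.
  rewrite !adjmx_col !mul_row_col !mulmx0 !addr0.
  have -> : \sum_j rdot (B j) (((2^-1)%:C *: Y *m Hi)^t* *m L j *m (W1 *m Ki)) = 2^-1 * fro2 Y.
    rewrite /fro2 -rdotZl [in RHS]/Y rdot_sumr; apply: eq_bigr => j _.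
    have -> : L j *m W1 *m X j = L j *m (W1 *m Ki) *m (Hi *m B j)^t*.
      by rewrite adjmxM !mulmxA.
    by rewrite rdot_mulr_adj trmxCK -(mulmxA (_^t*)) -rdotMl !mulmxA.
  have := le_fac _ _ S H ((2^-1)%:C *: Y *m Hi) HH.
  have := le_fac _ _ T K (W1 *m Ki) KK.
  rewrite -!mulmxA HiH KiK !mulmx1 fro2Z.
  move: (rdot S _) (rdot T _) (fro2 Y) (fro2 W1) => x y z w; lra.
have := LN _ _ X 4 (ler0n _ _) LX K; set Z := pact N X K.
have ZE : rdot H Z = \sum_j rdot (B j) (N j).
  rewrite rdot_sumr; apply: eq_bigr => j _.
  have -> : N j *m K *m X j = N j *m (Hi *m B j)^t*.
    by rewrite /X adjmxM -!mulmxA (mulmxA K) KKi mul1mx.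
  by rewrite rdot_mulr_adj trmxCK mulmxA HHi mul1mx.
have froF n (U F : 'M[C]_n) : F *m F^t* = - U + e%:C%:M ->
    fro2 F = - rdot U 1%:M + e * fro2 (1%:M : 'M[C]_n).
  move=> FF; rewrite -fro2_adj fro2_gram trmxCK FF rdotDr rdotNr.
  by rewrite [rdot _ U]rdotC -[e%:C%:M]scalemx1 rdotZr.
(* The weight [2] balances [|Z|^2 <= 4 |K|^2], so that [<H, Z> <= |H|^2 + |K|^2]. The left side is
   the pencil part of [D], the right side is [- tr S - tr T] up to a shift smaller than [D]. *)
have := rdot_le (2%:C *: H) Z; rewrite rdotZl fro2Z ZE (froF _ _ _ HH) (froF _ _ _ KK).
have DE : D = \sum_j rdot (B j) (N j) + rdot S 1%:M + rdot T 1%:M by [].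
move: ef; rewrite DE mulrDr.
move: (fro2 Z) (\sum_j _) (rdot S _) (rdot T _) (e * _) (e * _) => x y z u v w.
lra.
Qed.

End Factorization.

(** * Minimal pencils are rigid *)

Section Minimality.
Variable R : realType.
Local Notation C := R[i].
Variables (g p' p : nat) (Lt : pencil R g p' p).
Hypothesis g0 : (0 < g)%N.
Hypothesis Lmin : min_dim_pencil Lt.

Lemma pact_compress q' q m n (V' : 'M[C]_(p', q')) (V : 'M[C]_(p, q))
    (X : 'I_g -> 'M[C]_(m, n)) W :
  pact (fun j => V'^t* *m Lt j *m V) X W = V'^t* *m pact Lt X (V *m W).
Proof.
by rewrite /pact mulmx_sumr; apply: eq_bigr => j _; rewrite !mulmxA.
Qed.

Lemma kraus_pact (I : finType) a' a b' b m n (L : pencil R g a' a) (N : pencil R g b' b)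
    (P : I -> 'M[C]_(a', b')) (W : I -> 'M[C]_(a, b)) (X : 'I_g -> 'M[C]_(m, n)) Y U :
  kraus_map P W L N ->
  rdot Y (pact N X U) = \sum_k rdot (P k *m Y) (pact L X (W k *m U)).
Proof.
move=> kPW; rewrite /pact; under [RHS]eq_bigr do rewrite rdot_sumr.
rewrite exchange_big rdot_sumr; apply: eq_bigr => j _ /=.
rewrite -kPW !mulmx_suml rdot_sumr; apply: eq_bigr => k _.
by rewrite rdotMl !mulmxA.
Qed.

(* If a completely contractive map fixing [Lt] factors through a compression of
   [Lt], that compression defines the same ball, so minimality makes it full. *)
Lemma minimal_compression (I : finType) (P : I -> 'M[C]_p') (W : I -> 'M[C]_p)
    (E' : 'M[C]_p') (E : 'M[C]_p) :
  kraus_map P W Lt Lt -> subunital P -> subunital W ->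
  E'^t* = E' -> E' *m E' = E' -> E^t* = E -> E *m E = E ->
  (forall k, E' *m P k = P k) -> (forall k, E *m W k = W k) ->
  E' = 1%:M /\ E = 1%:M.
Proof.
move=> kPW Ps Ws EH' EE' EH EE EP EW.
have [q' [V' [VV' VE']]] := proj_factor EH' EE'.
have [q [V [VV VE]]] := proj_factor EH EE.
pose L1 : pencil R g q' q := fun j => V'^t* *m Lt j *m V.
have to n (X : 'I_g -> 'M[C]_n) c : 0 <= c -> bounded_at Lt X c -> bounded_at L1 X c.
  move=> c0 Lc U; rewrite pact_compress.
  by apply: le_trans (fro2_coisom _ VV') _; rewrite -(fro2_isom U VV).
have from n (X : 'I_g -> 'M[C]_n) c : 0 <= c -> bounded_at L1 X c -> bounded_at Lt X c.
  move=> c0 Lc U; set Y := pact Lt X U.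
  (* The Kraus formula splits [fro2 Y]; since [E'] fixes [P_k] and [E] fixes [W_k], each term sees
     only the compressed pencil, to which [Lc] applies. *)
  have h : 2 * fro2 Y <= \sum_k (fro2 (P k *m Y) + c * fro2 (W k *m U)).
    have -> : fro2 Y = _ := kraus_pact X Y U kPW.
    rewrite mulr_sumr; apply: ler_sum => k _.
    have -> Z : rdot (P k *m Y) Z = rdot (V'^t* *m (P k *m Y)) (V'^t* *m Z).
      by rewrite rdotC -{1}EP -VE' rdotC -!mulmxA rdotMl.
    apply: le_trans (rdot_le _ _) (lerD (fro2_coisom _ VV') _).
    have := Lc (V^t* *m (W k *m U)); rewrite pact_compress !mulmxA VE EW => h.
    by apply: (le_trans h); rewrite ler_wpM2l // -mulmxA; exact: fro2_coisom.
  have hP := subunital_mx Y Ps; have hW := ler_wpM2l c0 (subunital_mx U Ws).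
  move: h hP hW; rewrite big_split /= -mulr_sumr.
  by move: (c * fro2 U) (c * _) (\sum_k _) (fro2 Y) => x y z w; lra.
have [Lnd Ldim] := Lmin.
have L1nd : nondegenerate_pencil L1.
  apply/nondegenerate_bounded => n X X0.
  by move/nondegenerate_bounded: Lnd; apply; exact: from.
(* An empty compression would be degenerate, since [g > 0] leaves room for a nonzero [X]; positive
   sizes are required to compete with [Lt]. *)
have zero_nd (U : 'M[C]_1) : (q' == 0)%N || (q == 0)%N -> U = 0.
  move=> q0; have /nondegenerate_bounded/(_ 1%N (fun=> U)) := L1nd.
  move=> /(_ _ (Ordinal g0)) h; apply: h => Z.
  rewrite mul0r (_ : pact _ _ _ = 0) ?fro20 //.
  case/orP: q0 => /eqP q0; first by apply/matrixP => -[k hk]; exfalso; move: hk; rewrite q0.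
  rewrite (_ : Z = 0) /pact; last by apply/matrixP => -[k hk]; exfalso; move: hk; rewrite q0.
  by rewrite big1 // => j _; rewrite mulmx0 mul0mx.
have qp : ((0 < q') && (0 < q))%N.
  rewrite !lt0n -negb_or; apply/negP => /(zero_nd 1%:M)/matrixP/(_ 0 0)/eqP.
  by rewrite !mxE eqxx oner_eq0.
have /andP[q'0 q0] := qp.
have le := Ldim _ _ _ q'0 q0 L1nd
  (bounded_same_ball (fun n X c c0 => conj (@from n X c c0) (@to n X c c0))).
have q'p := isometry_dim VV'; have q_p := isometry_dim VV.
(* Neither size can grow and their positive product cannot shrink, so both are unchanged. *)
have [e' e] : q' = p' /\ q = p by nia.
by rewrite -VE' -VE (isometry_full VV' e') (isometry_full VV e).
Qed.

(** The projection onto the kernel of [H] fixes every [P_k], so minimality makes it the identity. *)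
Lemma minimal_left_faithful (I : finType) (P : I -> 'M[C]_p') (W : I -> 'M[C]_p) m
    (H : 'M[C]_(m, p')) :
  kraus_map P W Lt Lt -> subunital P -> subunital W ->
  (forall k, H *m P k = 0) -> H = 0.
Proof.
move=> kPW Ps Ws HP; have [k [B [M [M' [BB HM BM]]]]] := orthonormal_row_basis H.
have [||||k'|k'|/eqP E1 _] := @minimal_compression _ P W (1%:M - B^t* *m B) 1%:M kPW Ps Ws.
- by rewrite adjmxB adjmx1 adjmxM trmxCK.
- rewrite mulmxBl mul1mx mulmxBr mulmx1 -mulmxA (mulmxA B) BB mul1mx.
  by rewrite subrr subr0.
- exact: adjmx1.
- exact: mul1mx.
- by rewrite mulmxBl mul1mx -mulmxA [B *m _](_ : _ = 0) ?mulmx0 ?subr0 // BM -mulmxA HP mulmx0.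
- exact: mul1mx.
rewrite -subr_eq0 addrC addKr oppr_eq0 in E1.
by rewrite HM -[B]mul1mx -BB -mulmxA (eqP E1) !mulmx0.
Qed.

Lemma minimal_right_faithful (I : finType) (P : I -> 'M[C]_p') (W : I -> 'M[C]_p) m
    (H : 'M[C]_(m, p)) :
  kraus_map P W Lt Lt -> subunital P -> subunital W ->
  (forall k, H *m W k = 0) -> H = 0.
Proof.
move=> kPW Ps Ws HP; have [k [B [M [M' [BB HM BM]]]]] := orthonormal_row_basis H.
have [||||k'|k'|_ /eqP E1] := @minimal_compression _ P W 1%:M (1%:M - B^t* *m B) kPW Ps Ws.
- exact: adjmx1.
- exact: mul1mx.
- by rewrite adjmxB adjmx1 adjmxM trmxCK.
- rewrite mulmxBl mul1mx mulmxBr mulmx1 -mulmxA (mulmxA B) BB mul1mx.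
  by rewrite subrr subr0.
- exact: mul1mx.
- by rewrite mulmxBl mul1mx -mulmxA [B *m _](_ : _ = 0) ?mulmx0 ?subr0 // BM -mulmxA HP mulmx0.
rewrite -subr_eq0 addrC addKr oppr_eq0 in E1.
by rewrite HM -[B]mul1mx -BB -mulmxA (eqP E1) !mulmx0.
Qed.

End Minimality.

(** * Energy and rigidity of self-maps *)

Section Rigidity.
Variable R : realType.
Local Notation C := R[i].
Variables (g p' p : nat) (Lt : pencil R g p' p).

(** The two [Lt] sums answer to [kraus_schwarz] for a map and for its adjoint; the subtracted sums
    detect a loss of unitality. *)
Definition kraus_energy (I : finType) (P : I -> 'M[C]_p') (W : I -> 'M[C]_p) : R :=
  \sum_j \sum_k fro2 (Lt j *m W k) + \sum_j \sum_k fro2 ((Lt j)^t* *m P k)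
  - \sum_k fro2 (P k) - \sum_k fro2 (W k).

(** Energy and subunitality depend only on the positive maps [X |-> sum_k F_k^* X F_k], which
    [kraus_reduce] preserves. *)
Lemma sum_fro2_gram (I J : finType) m n q (A : 'M[C]_(m, n))
    (F : I -> 'M[C]_(n, q)) (G : J -> 'M[C]_(n, q)) :
  (forall X, \sum_k (F k)^t* *m X *m F k = \sum_k (G k)^t* *m X *m G k) ->
  \sum_k fro2 (A *m F k) = \sum_k fro2 (A *m G k).
Proof.
move=> FG; have gram (K : finType) (H : K -> 'M[C]_(n, q)) :
    \sum_k fro2 (A *m H k) = rdot 1%:M (\sum_k (H k)^t* *m (A^t* *m A) *m H k).
  rewrite rdot_sumr; apply: eq_bigr => k _.
  by have := fro2M (A *m H k) 1%:M; rewrite !mulmx1 adjmxM !mulmxA.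
by rewrite !gram FG.
Qed.

Lemma kraus_energy_gram (I J : finType) (P : I -> 'M[C]_p') (W : I -> 'M[C]_p)
    (Q : J -> 'M[C]_p') (V : J -> 'M[C]_p) :
  (forall X, \sum_k (P k)^t* *m X *m P k = \sum_k (Q k)^t* *m X *m Q k) ->
  (forall X, \sum_k (W k)^t* *m X *m W k = \sum_k (V k)^t* *m X *m V k) ->
  kraus_energy P W = kraus_energy Q V.
Proof.
move=> PQ WV; rewrite /kraus_energy.
have mul1 (K : finType) n (F : K -> 'M[C]_n) :
    \sum_k fro2 (F k) = \sum_k fro2 (1%:M *m F k).
  by apply: eq_bigr => k _; rewrite mul1mx.
rewrite [\sum_k fro2 (P k)]mul1 [\sum_k fro2 (W k)]mul1.
rewrite (sum_fro2_gram 1%:M PQ) (sum_fro2_gram 1%:M WV) -!mul1.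
congr (_ + _ - _ - _); apply: eq_bigr => j _.
  exact: (sum_fro2_gram (Lt j) WV).
exact: (sum_fro2_gram ((Lt j)^t*) PQ).
Qed.

Lemma subunital_gram (I J : finType) m n (P : I -> 'M[C]_(m, n)) (Q : J -> 'M[C]_(m, n)) :
  (forall X, \sum_k (P k)^t* *m X *m P k = \sum_k (Q k)^t* *m X *m Q k) ->
  subunital Q -> subunital P.
Proof.
move=> PQ Qs v; apply: le_trans (Qs v).
have gram (K : finType) (H : K -> 'M[C]_(m, n)) :
    \sum_k fro2 (H k *m v) = rdot v ((\sum_k (H k)^t* *m 1%:M *m H k) *m v).
  rewrite mulmx_suml rdot_sumr; apply: eq_bigr => k _.
  by rewrite mulmx1 fro2M.
by rewrite !gram PQ.
Qed.

Lemma subunital_bound (I : finType) m n (P : I -> 'M[C]_(m, n)) k :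
  subunital P -> fro2 (P k) <= fro2 (1%:M : 'M[C]_n).
Proof.
move=> /(subunital_mx 1%:M); apply: le_trans; under eq_bigr do rewrite mulmx1.
by rewrite (bigD1 k) //= lerDl; apply: sumr_ge0 => i _; exact: fro2_ge0.
Qed.

(** Over a fixed index the self-maps fixing [Lt] form a compact set: subunitality bounds the members
    and every condition is closed. The identity is one of them. *)
Lemma kraus_energy_max : exists (I : finType) (P0 : I -> 'M[C]_p') (W0 : I -> 'M[C]_p),
  [/\ kraus_map P0 W0 Lt Lt, subunital P0, subunital W0 &
      forall (J : finType) (P : J -> 'M[C]_p') (W : J -> 'M[C]_p),
        kraus_map P W Lt Lt -> subunital P -> subunital W ->
        kraus_energy P W <= kraus_energy P0 W0].
Proof.
pose E := kraus_ix p' p p' p.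
pose X := prod_topology (fun _ : (E * E) * bool => R : topologicalType).
pose Pt (t : X) (k : E) : 'M[C]_p' := krausP (kraus_of t k).
pose Wt (t : X) (k : E) : 'M[C]_p := krausW (kraus_of t k).
have cP k : mxcont (fun t : X => Pt t k) by exact: krausP_cont.
have cW k : mxcont (fun t : X => Wt t k) by exact: krausW_cont.
pose c (x : 'I_g + ('cV[C]_p' + 'cV[C]_p)) (t : X) : R :=
  match x with
  | inl j => fro2 (Lt j - \sum_k (Pt t k)^t* *m Lt j *m Wt t k)
  | inr (inl v) => \sum_k fro2 (Pt t k *m v) - fro2 v
  | inr (inr v) => \sum_k fro2 (Wt t k *m v) - fro2 v
  end.
have cAsum m n q (A : 'M[C]_(m, n)) (F : E -> X -> 'M[C]_(n, q)) :
    (forall k, mxcont (F k)) -> continuous (fun t => \sum_k fro2 (A *m F k t)).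
  move=> cF; apply: (@continuous_sumr R X E (fun k t => fro2 (A *m F k t))) => k.
  by apply: continuous_fro2; apply: mxcontM => //; exact: mxcont_cst.
have sub_cont m n (F : X -> E -> 'M[C]_(m, n)) (v : 'cV[C]_n) :
    (forall k, mxcont (F ^~ k)) -> continuous (fun t : X => \sum_k fro2 (F t k *m v) - fro2 v).
  move=> cF; apply: continuous_addr; last exact: continuous_cstr.
  apply: (@continuous_sumr R X E (fun k t => fro2 (F t k *m v))) => k.
  by apply: continuous_fro2; apply: mxcontM => //; exact: mxcont_cst.
have cc x : continuous (c x).
  case: x => [j|[v|v]] /=; [|exact: sub_cont|exact: sub_cont].
  apply: continuous_fro2; apply: mxcontB; first exact: mxcont_cst.
  apply: mxcont_sum => k; apply: mxcontM => //; apply: mxcontM; last exact: mxcont_cst.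
  exact: mxcont_adj.
have cF : continuous (fun t : X => - kraus_energy (Pt t) (Wt t)).
  apply: continuous_oppr; rewrite /kraus_energy.
  have c1 : continuous (fun t : X => \sum_j \sum_k fro2 (Lt j *m Wt t k)).
    apply: (@continuous_sumr R X _ (fun j t => \sum_k fro2 (Lt j *m Wt t k))) => j.
    exact: (cAsum _ _ _ (Lt j) (fun k t => Wt t k)).
  have c2 : continuous (fun t : X => \sum_j \sum_k fro2 ((Lt j)^t* *m Pt t k)).
    apply: (@continuous_sumr R X _ (fun j t => \sum_k fro2 ((Lt j)^t* *m Pt t k))) => j.
    exact: (cAsum _ _ _ ((Lt j)^t*) (fun k t => Pt t k)).
  have c3 : continuous (fun t : X => \sum_k fro2 (Pt t k)).
    by apply: (@continuous_sumr R X E (fun k t => fro2 (Pt t k))) => k; exact: continuous_fro2.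
  have c4 : continuous (fun t : X => \sum_k fro2 (Wt t k)).
    by apply: (@continuous_sumr R X E (fun k t => fro2 (Wt t k))) => k; exact: continuous_fro2.
  exact: (continuous_addr
    (continuous_addr (continuous_addr c1 c2) (continuous_oppr c3)) (continuous_oppr c4)).
have cE t : (forall x, c x t <= 0) <->
    [/\ kraus_map (Pt t) (Wt t) Lt Lt, subunital (Pt t) & subunital (Wt t)].
  split=> [h|[h1 h2 h3] [j|[v|v]]] /=; last 2 first.
  - by rewrite subr_le0; exact: h2.
  - by rewrite subr_le0; exact: h3.
  - split=> [j|v|v].
    + by apply/esym/eqP; rewrite -subr_eq0; apply/eqP/fro2_le0; exact: (h (inl j)).
    + by rewrite -subr_le0; exact: (h (inr (inl v))).
    + by rewrite -subr_le0; exact: (h (inr (inr v))).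
  - by rewrite h1 subrr fro20.
pose B := fro2 (1%:M : 'M[C]_p') + fro2 (1%:M : 'M[C]_p) + 1.
have [B0 BP BW] : [/\ 0 <= B, fro2 (1%:M : 'M[C]_p') <= B ^+ 2 & fro2 (1%:M : 'M[C]_p) <= B ^+ 2].
  rewrite /B; move: (fro2_ge0 (1%:M : 'M[C]_p')) (fro2_ge0 (1%:M : 'M[C]_p)).
  by move: (fro2 _) (fro2 _) => x y x0 y0; split; nra.
have inbox t : (forall x, c x t <= 0) -> forall x, `|t x| <= B.
  move=> /cE[_ Ps Ws]; apply: (@kraus_of_bound R p' p p' p t B B0) => k.
    exact: le_trans (subunital_bound k Ps) BP.
  exact: le_trans (subunital_bound k Ws) BW.
have reach (J : finType) (P : J -> 'M[C]_p') (W : J -> 'M[C]_p) :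
    kraus_map P W Lt Lt -> subunital P -> subunital W ->
    exists t : X, (forall x, c x t <= 0) /\ kraus_energy P W = kraus_energy (Pt t) (Wt t).
  move=> kPW Ps Ws; have [f [fPW fP fW]] := kraus_reduce P W.
  have [t tf] := kraus_ofK f; exists t; rewrite /Pt /Wt tf; split.
    apply/cE; rewrite /Pt /Wt tf; split.
    - by move=> j; rewrite fPW kPW.
    - exact: (subunital_gram fP).
    - exact: (subunital_gram fW).
  by apply: kraus_energy_gram => Z; rewrite ?fP ?fW.
have id_sub n : subunital (fun _ : unit => 1%:M : 'M[C]_n).
  by move=> v; rewrite (big_pred1 tt) => [|[]] //; rewrite mul1mx.
have [|t0 [ct0 _]] := reach _ (fun _ : unit => 1%:M) (fun=> 1%:M) _ (id_sub _) (id_sub _).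
  by move=> j; rewrite (big_pred1 tt) => [|[]] //; rewrite adjmx1 mul1mx mulmx1.
have [|t [tB ct tmin]] := box_min cc cF (M := B).
  by exists t0; split => //; exact: inbox.
have [kPW Ps Ws] : [/\ kraus_map (Pt t) (Wt t) Lt Lt, subunital (Pt t) & subunital (Wt t)].
  exact/cE.
exists E, (Pt t), (Wt t); split => // J P W kP sP sW.
have [t' [ct' ->]] := reach _ _ _ kP sP sW.
by rewrite -lerN2; apply: tmin => //; exact: inbox.
Qed.

Hypothesis g0 : (0 < g)%N.
Hypothesis Lmin : min_dim_pencil Lt.

(* Composing with an energy maximiser [P0], [W0] cannot raise the energy, so
   every defect in the Schwarz inequality of [P], [W] is killed by the maximiser,
   and hence vanishes by faithfulness. *)
Theorem kraus_rigidity (I : finType) (P : I -> 'M[C]_p') (W : I -> 'M[C]_p) :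
  kraus_map P W Lt Lt -> subunital P -> subunital W ->
  [/\ \sum_k (P k)^t* *m P k = 1%:M, \sum_k (W k)^t* *m W k = 1%:M,
      forall j k, Lt j *m W k = P k *m Lt j &
      forall j k, (Lt j)^t* *m P k = W k *m (Lt j)^t*].
Proof.
move=> kPW Ps Ws.
have [E [P0 [W0 [k0 Ps0 Ws0 maxE]]]] := kraus_energy_max.
have [Z ZE] := subunital_defect Ps; have [U UE] := subunital_defect Ws.
have pairE (f : I -> E -> R) : \sum_(x : I * E) f x.1 x.2 = \sum_a \sum_k f k a.
  by rewrite -(pair_bigA _ f) exchange_big.
have := maxE _ _ _ (kraus_map_comp kPW k0) (subunital_comp Ps Ps0) (subunital_comp Ws Ws0).
pose D1 j := \sum_a \sum_k fro2 ((Lt j *m W k - P k *m Lt j) *m W0 a).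
pose D2 j := \sum_a \sum_k fro2 (((Lt j)^t* *m P k - W k *m (Lt j)^t*) *m P0 a).
have schwarz j : D1 j + \sum_a fro2 (Lt j *m W0 a)
    <= \sum_(x : I * E) fro2 (Lt j *m (W x.1 *m W0 x.2)).
  rewrite (pairE (fun k a => fro2 (Lt j *m (W k *m W0 a)))) -big_split.
  apply: ler_sum => a _; have := kraus_schwarz (W0 a) Ps (kPW j).
  by under [X in _ <= X -> _]eq_bigr do rewrite -mulmxA.
have schwarz' j : D2 j + \sum_a fro2 ((Lt j)^t* *m P0 a)
    <= \sum_(x : I * E) fro2 ((Lt j)^t* *m (P x.1 *m P0 x.2)).
  rewrite (pairE (fun k a => fro2 ((Lt j)^t* *m (P k *m P0 a)))) -big_split.
  apply: ler_sum => a _; have := kraus_schwarz (P0 a) Ws (kraus_map_adj kPW j).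
  by under [X in _ <= X -> _]eq_bigr do rewrite -mulmxA.
have defect m n (F : I -> 'M[C]_(m, n)) (F0 : E -> 'M[C]_n) (V : 'M[C]_n) :
    V^t* *m V = 1%:M - \sum_k (F k)^t* *m F k ->
    \sum_(x : I * E) fro2 (F x.1 *m F0 x.2) = \sum_a fro2 (F0 a) - \sum_a fro2 (V *m F0 a).
  move=> VE; rewrite (pairE (fun k a => fro2 (F k *m F0 a))) -sumrB.
  by apply: eq_bigr => a _; rewrite (fro2_defect _ VE) subKr.
have sum_le (f h : 'I_g -> R) : (forall j, f j <= h j) -> \sum_j f j <= \sum_j h j.
  by move=> fh; apply: ler_sum.
have sum_ge0 (f : 'I_g -> R) : (forall j, 0 <= f j) -> 0 <= \sum_j f j.
  by move=> f0; apply: sumr_ge0.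
have s1 := sum_le _ _ schwarz; have s2 := sum_le _ _ schwarz'.
rewrite /kraus_energy (defect _ _ P P0 Z ZE) (defect _ _ W W0 U UE) => le.
have D10 j : 0 <= D1 j by apply: sumr_ge0 => a _; apply: sumr_ge0 => k _; exact: fro2_ge0.
have D20 j : 0 <= D2 j by apply: sumr_ge0 => a _; apply: sumr_ge0 => k _; exact: fro2_ge0.
have nonneg m n (F : 'M[C]_n) (G : E -> 'M[C]_(n, m)) : 0 <= \sum_a fro2 (F *m G a).
  by apply: sumr_ge0 => a _; exact: fro2_ge0.
(* By maximality the composite gains no energy, yet its gain is at least a sum of these nonnegative
   defects. *)
have [d1 d2 zP uW] : [/\ \sum_j D1 j <= 0, \sum_j D2 j <= 0,
    \sum_a fro2 (Z *m P0 a) <= 0 & \sum_a fro2 (U *m W0 a) <= 0].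
  move: s1 s2 le; rewrite !big_split /=.
  move: (sum_ge0 _ D10) (sum_ge0 _ D20).
  move: (nonneg _ _ Z P0) (nonneg _ _ U W0).
  move: (\sum_a fro2 (Z *m P0 a)) (\sum_a fro2 (U *m W0 a)) (\sum_j D1 j) (\sum_j D2 j).
  move: (\sum_a fro2 (P0 a)) (\sum_a fro2 (W0 a)).
  move: (\sum_j \sum_a _) (\sum_j \sum_a _) (\sum_j \sum_a _) (\sum_j \sum_a _).
  by move=> x1 x2 x3 x4 x5 x6 x7 x8 x9 x10 *; split; lra.
have sum0 (J : finType) (f : J -> R) : (forall x, 0 <= f x) -> \sum_x f x <= 0 ->
    forall x, f x <= 0.
  by move=> f0 le0 x; apply: le_trans le0; rewrite (bigD1 x) //= lerDl sumr_ge0.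
have left m (F : 'M[C]_(m, p')) : (forall a, fro2 (F *m P0 a) <= 0) -> F = 0.
  by move=> F0; apply: (minimal_left_faithful g0 Lmin k0 Ps0 Ws0) => a; exact: fro2_le0.
have right m (F : 'M[C]_(m, p)) : (forall a, fro2 (F *m W0 a) <= 0) -> F = 0.
  by move=> F0; apply: (minimal_right_faithful g0 Lmin k0 Ps0 Ws0) => a; exact: fro2_le0.
have f0 m n (F : 'M[C]_(m, n)) := fro2_ge0 F.
split.
- have Z0 : Z = 0 by apply: left; apply: sum0.
  by move: ZE; rewrite Z0 mulmx0 => /esym/eqP; rewrite subr_eq0 => /eqP ->.
- have U0 : U = 0 by apply: right; apply: sum0.
  by move: UE; rewrite U0 mulmx0 => /esym/eqP; rewrite subr_eq0 => /eqP ->.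
- move=> j k; apply/eqP; rewrite -subr_eq0; apply/eqP/right => a.
  have row := sum0 _ _ _ (sum0 _ _ D10 d1 j).
  by apply: (sum0 _ _ _ (row _ a)) => // b; apply: sumr_ge0.
- move=> j k; apply/eqP; rewrite -subr_eq0; apply/eqP/left => a.
  have row := sum0 _ _ _ (sum0 _ _ D20 d2 j).
  by apply: (sum0 _ _ _ (row _ a)) => // b; apply: sumr_ge0.
Qed.

End Rigidity.

(** * Intertwiners *)

Lemma unitary_conj_commute (C : numClosedFieldType) m n (U' D' : 'M[C]_m)
    (U D : 'M[C]_n) (X : 'M[C]_(m, n)) :
  U'^t* *m U' = 1%:M -> U' *m U'^t* = 1%:M -> U^t* *m U = 1%:M -> U *m U^t* = 1%:M ->
  X *m (U^t* *m D *m U) = U'^t* *m D' *m U' *m X <->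
  U' *m X *m U^t* *m D = D' *m (U' *m X *m U^t*).
Proof.
move=> u1 u2 u3 u4; split=> [/(congr1 (fun M => U' *m M *m U^t*)) /=|].
  by rewrite !mulmxA u2 mul1mx -!(mulmxA _ U) u4 !mulmx1.
move=> /(congr1 (fun M => U'^t* *m M *m U)) /=.
by rewrite !mulmxA u1 mul1mx => ->; rewrite -!(mulmxA _ (U^t*)) u3 !mulmx1.
Qed.

Lemma selfadjoint_commute (C : numClosedFieldType) m n (N : 'M[C]_(m, n))
    (H' : 'M[C]_m) (H : 'M[C]_n) :
  H'^t* = H' -> H^t* = H -> N *m H = H' *m N -> N^t* *m H' = H *m N^t*.
Proof. by move=> h' h NH; rewrite -{1}h' -adjmxM -NH adjmxM h. Qed.

Section Intertwiners.
Variable R : realType.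
Local Notation C := R[i].

Definition intertwines g a' a b' b (L : pencil R g a' a) (N : pencil R g b' b)
    (S' : 'M[C]_(a', b')) (S : 'M[C]_(a, b)) :=
  forall j, L j *m S = S' *m N j /\ (L j)^t* *m S' = S *m (N j)^t*.

Lemma intertwines_comp g a' a b' b c' c
    (L : pencil R g a' a) (M : pencil R g b' b) (N : pencil R g c' c) S' S T' T :
  intertwines L M S' S -> intertwines M N T' T ->
  intertwines L N (S' *m T') (S *m T).
Proof.
move=> LM MN j; have [l1 l2] := LM j; have [m1 m2] := MN j; split.
  by rewrite mulmxA l1 -[in LHS]mulmxA m1 mulmxA.
by rewrite mulmxA l2 -[in LHS]mulmxA m2 mulmxA.
Qed.

Lemma intertwines_adj g a' a b' b (L : pencil R g a' a) (N : pencil R g b' b) S' S :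
  intertwines L N S' S -> intertwines N L (S'^t*) (S^t*).
Proof.
move=> LN j; have [l1 l2] := LN j; split.
  by rewrite -[LHS]trmxCK adjmxM trmxCK -l2 adjmxM trmxCK.
by rewrite -adjmxM -l1 adjmxM.
Qed.

Lemma intertwines1 g a' a (L : pencil R g a' a) : intertwines L L 1%:M 1%:M.
Proof. by move=> j; rewrite !mulmx1 !mul1mx. Qed.

Lemma intertwinesB g a' a b' b (L : pencil R g a' a) (N : pencil R g b' b) S' S T' T :
  intertwines L N S' S -> intertwines L N T' T -> intertwines L N (S' - T') (S - T).
Proof.
move=> h1 h2 j; have [l1 l2] := h1 j; have [m1 m2] := h2 j.
by rewrite !mulmxBr !mulmxBl l1 l2 m1 m2.
Qed.

Lemma intertwinesD g a' a b' b (L : pencil R g a' a) (N : pencil R g b' b) S' S T' T :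
  intertwines L N S' S -> intertwines L N T' T -> intertwines L N (S' + T') (S + T).
Proof.
move=> h1 h2 j; have [l1 l2] := h1 j; have [m1 m2] := h2 j.
by rewrite !mulmxDr !mulmxDl l1 l2 m1 m2.
Qed.

(** Functional calculus for the Hermitian matrix [hfun U d id]. *)
Definition hfun n (U : 'M[C]_n) (d : 'I_n -> R) (f : R -> R) : 'M[C]_n :=
  U^t* *m diag_mx (\row_i (f (d i))%:C) *m U.

Lemma hfun_adj n (U : 'M[C]_n) d f : (hfun U d f)^t* = hfun U d f.
Proof. by rewrite /hfun !adjmxM trmxCK adjmx_diag_real mulmxA. Qed.

Lemma hfunM n (U : 'M[C]_n) d f h : U *m U^t* = 1%:M ->
  hfun U d f *m hfun U d h = hfun U d (fun x => f x * h x).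
Proof.
move=> UU; rewrite /hfun -!mulmxA (mulmxA U) UU mul1mx.
by rewrite (mulmxA (diag_mx _)) mul_diag_real.
Qed.

(** In the two eigenbases an entry of [X] is zero unless its row and column eigenvalues agree, and
    then [f] agrees on them. *)
Lemma hfun_commute m n (U' : 'M[C]_m) (U : 'M[C]_n) d' d f (X : 'M[C]_(m, n)) :
  U'^t* *m U' = 1%:M -> U' *m U'^t* = 1%:M -> U^t* *m U = 1%:M -> U *m U^t* = 1%:M ->
  X *m hfun U d id = hfun U' d' id *m X -> X *m hfun U d f = hfun U' d' f *m X.
Proof.
move=> u1 u2 u3 u4; rewrite /hfun => /(unitary_conj_commute _ _ _ u1 u2 u3 u4) hY.
apply/(unitary_conj_commute _ _ _ u1 u2 u3 u4); apply/matrixP => a b.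
have /matrixP/(_ a b) := hY; rewrite !mul_mx_diag !mul_diag_mx.
move: (U' *m X *m U^t*) => Y; rewrite !mxE mulrC => e.
have [->|y0] := eqVneq (Y a b) 0; first by rewrite mul0r mulr0.
by have /complexI -> := mulIf y0 e; rewrite mulrC.
Qed.

Lemma eq_hfun n (U : 'M[C]_n) d f h :
  (forall i, f (d i) = h (d i)) -> hfun U d f = hfun U d h.
Proof.
move=> fh; rewrite /hfun; suff -> : \row_i (f (d i))%:C = \row_i (h (d i))%:C :> 'rV[C]_n.
  by [].
by apply/rowP => i; rewrite !mxE fh.
Qed.

Lemma fro2_eq0_mul m n p (A : 'M[C]_(m, n)) (B : 'M[C]_(n, p)) :
  A^t* *m A *m B = 0 -> A *m B = 0.
Proof. by move=> AAB; apply: fro2_le0; rewrite fro2M AAB rdot0r. Qed.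

(** The value at [0] gives an inverse square root on the support and zero on the kernel. *)
Definition inv_sqrt (x : R) : R := if x == 0 then 0 else (Num.sqrt x)^-1.

(** [K^* K] is the support projection of [S^* S], and [S = K sqrt(S^* S)] shows that no rank is
    lost. *)
Lemma polar_mx m n (S : 'M[C]_(m, n)) :
  exists (U : 'M[C]_n) (d : 'I_n -> R), let K := S *m hfun U d inv_sqrt in
  [/\ U^t* *m U = 1%:M, U *m U^t* = 1%:M, S^t* *m S = hfun U d id,
      K^t* *m K *m (K^t* *m K) = K^t* *m K & (\rank S <= \rank K)%N].
Proof.
have [||U [d [u1 u2 d0 SE]]] := @psd_spectral R _ (S^t* *m S).
- by rewrite adjmxM trmxCK.
- by move=> v; rewrite -fro2M fro2_ge0.
have {}SE : S^t* *m S = hfun U d id := SE.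
pose e (x : R) : R := (x != 0)%:R.
have eE : hfun U d inv_sqrt *m hfun U d id *m hfun U d inv_sqrt = hfun U d e.
  rewrite (hfunM _ _ _ u2) (hfunM _ _ _ u2); apply: eq_hfun => i; rewrite /inv_sqrt /e.
  have [->|x0] := eqVneq (d i) 0; first by rewrite !mul0r.
  have s0 : Num.sqrt (d i) != 0 by rewrite sqrtr_eq0 -ltNge lt_neqAle eq_sym x0 d0.
  by rewrite -{2}(sqr_sqrtr (d0 i)) expr2 mulKf // divff.
exists U, d => K.
have KK : K^t* *m K = hfun U d e.
  have gram (H : 'M[C]_n) : H^t* = H -> (S *m H)^t* *m (S *m H) = H *m (S^t* *m S) *m H.
    by move=> HH; rewrite adjmxM HH !mulmxA.
  by rewrite /K (gram _ (hfun_adj _ _ _)) SE eE.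
split => //.
  by rewrite KK (hfunM _ _ _ u2); apply: eq_hfun => i; rewrite /e -natrM mulnb andbb.
have -> : S = K *m hfun U d Num.sqrt; last exact: mxrankM_maxl.
apply/eqP; rewrite -subr_eq0 /K -mulmxA (hfunM _ _ _ u2).
rewrite -[X in X - _]mulmx1 -mulmxBr; apply/eqP/fro2_eq0_mul.
rewrite SE mulmxBr mulmx1 (hfunM _ _ _ u2); apply/eqP; rewrite subr_eq0; apply/eqP.
apply: eq_hfun => i; rewrite /inv_sqrt; have [->|x0] := eqVneq (d i) 0.
  by rewrite !mul0r.
by rewrite mulVf ?mulr1 // sqrtr_eq0 -ltNge lt_neqAle eq_sym x0 d0.
Qed.

(** [S'^* S'] and [S^* S] intertwine [N] with itself, and applying one function to both keeps
    this. *)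
Lemma intertwines_polar g a' a b' b (L : pencil R g a' a) (N : pencil R g b' b) S' S :
  intertwines L N S' S ->
  exists K' K, [/\ intertwines L N K' K,
    K'^t* *m K' *m (K'^t* *m K') = K'^t* *m K', K^t* *m K *m (K^t* *m K) = K^t* *m K,
    (\rank S' <= \rank K')%N & (\rank S <= \rank K)%N].
Proof.
move=> LN.
have [U' [d' [u1' u2' SE' KE' rk']]] := polar_mx S'.
have [U [d [u1 u2 SE KE rk]]] := polar_mx S.
exists (S' *m hfun U' d' inv_sqrt), (S *m hfun U d inv_sqrt); split => //.
have comm : intertwines N N (S'^t* *m S') (S^t* *m S).
  exact: intertwines_comp (intertwines_adj LN) LN.
apply: (intertwines_comp LN) => j; have [c1 c2] := comm j; rewrite SE SE' in c1 c2.
have h1 : N j *m hfun U d inv_sqrt = hfun U' d' inv_sqrt *m N j by exact: hfun_commute.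
by split; [exact: h1 | exact: selfadjoint_commute (hfun_adj _ _ _) (hfun_adj _ _ _) h1].
Qed.

Lemma partial_isometry m n (K : 'M[C]_(m, n)) :
  K^t* *m K *m (K^t* *m K) = K^t* *m K -> K *m (K^t* *m K) = K.
Proof.
move=> KK; apply/eqP; rewrite -subr_eq0 -[X in _ - X]mulmx1 -mulmxBr.
by apply/eqP/fro2_eq0_mul; rewrite mulmxBr KK mulmx1 subrr.
Qed.

End Intertwiners.

(** [Z] lives on the kernel of [K] and maps into the complement of its range, so [K K^*] recovers
    [K] from [K + Z]. If the rank does not grow, the row spaces agree, so [K + Z] vanishes on the
    kernel of [K], where it equals [Z]. *)
Lemma partial_isometry_extend (C : numClosedFieldType) m n (K T : 'M[C]_(m, n)) :
  K *m (K^t* *m K) = K ->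
  let Z := (1%:M - K *m K^t*) *m (T *m (1%:M - K^t* *m K)) in
  (\rank K <= \rank (K + Z)%R)%N /\ ((\rank (K + Z)%R <= \rank K)%N -> Z = 0).
Proof.
move=> KE Z.
have KD : K *m (1%:M - K^t* *m K) = 0 by rewrite mulmxBr mulmx1 KE subrr.
have ZD : Z *m (1%:M - K^t* *m K) = Z.
  by rewrite /Z -!mulmxA [(1%:M - K^t* *m K) *m _]mulmxBl mul1mx -[K^t* *m K *m _]mulmxA KD mulmx0 subr0.
have FA : K *m K^t* *m (K + Z) = K.
  rewrite mulmxDr -mulmxA KE /Z mulmxA mulmxBr mulmx1.
  by rewrite -!mulmxA (mulmxA (K^t*)) (mulmxA K) KE subrr mul0mx addr0.
split=> [|rk]; first by have := mxrankM_maxr (K *m K^t*) (K + Z); rewrite FA.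
have /geq_leqif := mxrank_leqif_sup (submxMl (K *m K^t*) (K + Z)).
rewrite {1}FA rk => /esym/submxP[Y AE].
have : (K + Z) *m (1%:M - K^t* *m K) = 0 by rewrite AE FA -mulmxA KD mulmx0.
by rewrite mulmxDl KD add0r ZD.
Qed.

(** Each [P_k] maps the kernel of [K] into its range, where [K^*] is isometric, so the Gram sum on
    that kernel is still the identity. *)
Lemma partial_isometry_gram (C : numClosedFieldType) (I : finType) m n
    (K : 'M[C]_(m, n)) (P : I -> 'M[C]_(m, n)) :
  K *m (K^t* *m K) = K -> \sum_k (P k)^t* *m P k = 1%:M ->
  (forall k, (1%:M - K *m K^t*) *m (P k *m (1%:M - K^t* *m K)) = 0) ->
  \sum_k (K^t* *m (P k *m (1%:M - K^t* *m K)))^t* *m (K^t* *m (P k *m (1%:M - K^t* *m K)))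
  = 1%:M - K^t* *m K.
Proof.
move=> KE PP absorbed; set D := 1%:M - K^t* *m K in absorbed *.
have DD : D^t* *m D = D.
  rewrite /D adjmxB adjmx1 adjmxM trmxCK mulmxBl mul1mx mulmxBr mulmx1 -mulmxA KE.
  by rewrite subrr subr0.
transitivity (D^t* *m (\sum_k (P k)^t* *m P k) *m D); last by rewrite PP mulmx1.
rewrite mulmx_sumr mulmx_suml; apply: eq_bigr => k _.
have /eqP := absorbed k; rewrite mulmxBl mul1mx subr_eq0 => /eqP e.
by rewrite adjmxM trmxCK -mulmxA (mulmxA K) -e adjmxM -!mulmxA.
Qed.

(** * Isometric embedding of a minimal pencil *)

Section Embedding.
Variable R : realType.
Local Notation C := R[i].

(** The Schwarz inequality of the second map bounds [|A W_k|^2] by terms of the composite, whose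
    total is at most [|B|^2] by commutation and subunitality. This leaves no room for a defect in
    the Schwarz inequality of the first map. *)
Lemma schwarz_equality (I J : finType) a' a b' b
    (P : I -> 'M[C]_(a', b')) (W : I -> 'M[C]_(a, b))
    (P2 : J -> 'M[C]_(b', a')) (W2 : J -> 'M[C]_(b, a))
    (A : 'M[C]_(a', a)) (B : 'M[C]_(b', b)) :
  subunital P -> subunital P2 ->
  \sum_k (P k)^t* *m A *m W k = B -> \sum_k (P2 k)^t* *m B *m W2 k = A ->
  (forall x : J * I, B *m (W2 x.1 *m W x.2) = P2 x.1 *m P x.2 *m B) ->
  forall k, A *m W k = P k *m B.
Proof.
move=> Ps P2s AB BA comm k.
have up k0 : fro2 (A *m W k0) <= \sum_l fro2 (B *m W2 l *m W k0).
  have := kraus_schwarz (W k0) P2s BA; apply: le_trans.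
  by rewrite lerDr; apply: sumr_ge0 => l _; exact: fro2_ge0.
have tot : \sum_k fro2 (A *m W k) <= fro2 B.
  apply: (le_trans (ler_sum _ (fun k0 _ => up k0))).
  have := subunital_mx B (subunital_comp P2s Ps); apply: le_trans.
  rewrite -(pair_bigA _ (fun l k0 => fro2 (P2 l *m P k0 *m B))) exchange_big /=.
  apply: ler_sum => k0 _; apply: ler_sum => l _.
  by rewrite -mulmxA (comm (l, k0)).
have := kraus_schwarz 1%:M Ps AB; rewrite mulmx1.
under eq_bigr do rewrite mulmx1; under [X in _ <= X -> _]eq_bigr do rewrite mulmx1.
move=> h; have {}h : \sum_k fro2 (A *m W k - P k *m B) <= 0.
  by rewrite -(lerD2r (fro2 B)) add0r (le_trans h).
apply/eqP; rewrite -subr_eq0; apply/eqP/fro2_le0; apply: le_trans h.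
by rewrite (bigD1 k) //= lerDl; apply: sumr_ge0 => i _; exact: fro2_ge0.
Qed.

(** The squared norms of the products sum to that of [1] and are dominated by those of the [P_k], so
    the defect of [P] has norm zero. *)
Lemma unital_of_comp (I J : finType) a b c
    (P2 : J -> 'M[C]_(c, a)) (P : I -> 'M[C]_(a, b)) :
  subunital P2 -> subunital P ->
  \sum_(x : J * I) (P2 x.1 *m P x.2)^t* *m (P2 x.1 *m P x.2) = 1%:M ->
  \sum_k (P k)^t* *m P k = 1%:M.
Proof.
move=> P2s Ps PP; have [Z ZE] := subunital_defect Ps.
suff Z0 : Z = 0.
  by move: ZE; rewrite Z0 mulmx0 => /esym/eqP; rewrite subr_eq0 => /eqP ->.
apply: fro2_le0; have := fro2_defect 1%:M ZE; rewrite mulmx1 => ->.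
rewrite subr_le0 [X in X <= _](_ : _ = \sum_(x : J * I) fro2 (P2 x.1 *m P x.2)).
  rewrite -(pair_bigA _ (fun l k => fro2 (P2 l *m P k))) exchange_big /=.
  by apply: ler_sum => k _; rewrite mulmx1; exact: subunital_mx.
rewrite [LHS]/fro2 -{2}PP rdot_sumr; apply: eq_bigr => x _.
by rewrite -fro2_gram.
Qed.

Lemma subunital_of_gram (I : finType) m n (P : I -> 'M[C]_(m, n)) :
  \sum_k (P k)^t* *m P k = 1%:M -> subunital P.
Proof.
move=> PP v; rewrite [X in _ <= X](_ : _ = \sum_k fro2 (P k *m v)) //.
rewrite [LHS]/fro2 -{2}[v]mul1mx -PP mulmx_suml rdot_sumr.
by apply: eq_bigr => k _; rewrite fro2M.
Qed.

Section Minimal.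
Variables (g d' d p' p : nat) (L : pencil R g d' d) (Lt : pencil R g p' p).
Hypothesis g0 : (0 < g)%N.
Hypotheses (Lmin : min_dim_pencil Lt) (LtL : same_ball Lt L).

Lemma kraus_intertwiners :
  exists (I : finType) (P : I -> 'M[C]_(d', p')) (W : I -> 'M[C]_(d, p)),
  [/\ \sum_k (P k)^t* *m P k = 1%:M, \sum_k (W k)^t* *m W k = 1%:M &
      forall k, intertwines L Lt (P k) (W k)].
Proof.
have LLt : same_ball L Lt by move=> n; rewrite LtL.
have [I [P [W [kPW Ps Ws]]]] := bounded_factorization
  (fun m n X c => @same_ball_bounded R _ _ _ _ _ m n L Lt X c LLt).
have [J [P2 [W2 [kPW2 P2s W2s]]]] := bounded_factorization
  (fun m n X c => @same_ball_bounded R _ _ _ _ _ m n Lt L X c LtL).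
have [PP WW c1 c2] := kraus_rigidity g0 Lmin (kraus_map_comp kPW2 kPW)
  (subunital_comp P2s Ps) (subunital_comp W2s Ws).
exists I, P, W; split.
- exact: unital_of_comp P2s Ps PP.
- exact: unital_of_comp W2s Ws WW.
- move=> k j; split.
    by apply: (schwarz_equality Ps P2s (kPW j) (kPW2 j)) => x; rewrite c1.
  apply: (schwarz_equality Ws W2s (kraus_map_adj kPW j) (kraus_map_adj kPW2 j)) => x.
  exact: c2.
Qed.

Lemma maximal_partial_isometry :
  exists (K' : 'M[C]_(d', p')) (K : 'M[C]_(d, p)),
  [/\ intertwines L Lt K' K,
      K'^t* *m K' *m (K'^t* *m K') = K'^t* *m K', K^t* *m K *m (K^t* *m K) = K^t* *m K &
      forall S' S, intertwines L Lt S' S -> (\rank S' + \rank S <= \rank K' + \rank K)%N].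
Proof.
pose rk (n : nat) := `[< exists S' S, intertwines L Lt S' S /\ (\rank S' + \rank S)%N = n >].
have rk0 : exists n, rk n.
  exists 0%N; apply/asboolP; exists 0, 0; rewrite !mxrank0; split => // j.
  by rewrite !mulmx0 !mul0mx.
have rkb n : rk n -> (n <= p' + p)%N.
  by move=> /asboolP[S' [S [_ <-]]]; rewrite leq_add ?rank_leq_col.
case: (ex_maxnP rk0 rkb) => n /asboolP[S' [S [LS <-]]] nmax.
have [K' [K [LK KK' KK r' r]]] := intertwines_polar LS.
exists K', K; split => // T' T LT; apply: leq_trans (leq_add r' r).
by apply: nmax; apply/asboolP; exists T', T.
Qed.

(* Had some intertwiner a component from [ker K] into the complement of the range
   of [K], adding it to [K] would raise the rank; so all intertwiners carry
   [ker K] into the range of [K], which makes that part of [Lt] redundant. *)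
Theorem isometric_intertwiner :
  exists (K' : 'M[C]_(d', p')) (K : 'M[C]_(d, p)),
  [/\ intertwines L Lt K' K, K'^t* *m K' = 1%:M & K^t* *m K = 1%:M].
Proof.
have [K' [K [LK pK' pK maxK]]] := maximal_partial_isometry.
have [I [P [W [PP WW PW]]]] := kraus_intertwiners.
have KE' := partial_isometry pK'; have KE := partial_isometry pK.
have LE : intertwines Lt Lt (K'^t* *m K') (K^t* *m K).
  exact: intertwines_comp (intertwines_adj LK) LK.
have LF : intertwines L L (K' *m K'^t*) (K *m K^t*).
  exact: intertwines_comp LK (intertwines_adj LK).
have LD : intertwines Lt Lt (1%:M - K'^t* *m K') (1%:M - K^t* *m K).
  exact: intertwinesB (intertwines1 Lt) LE.
have absorbed k : (1%:M - K' *m K'^t*) *m (P k *m (1%:M - K'^t* *m K')) = 0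
    /\ (1%:M - K *m K^t*) *m (W k *m (1%:M - K^t* *m K)) = 0.
  have LZ := intertwines_comp (intertwinesB (intertwines1 L) LF) (intertwines_comp (PW k) LD).
  have rK := maxK _ _ (intertwinesD LK LZ).
  have [r1' r2'] := partial_isometry_extend (P k) KE'.
  have [r1 r2] := partial_isometry_extend (W k) KE.
  (* Neither rank drops and their sum does not grow, so each is unchanged. *)
  have squeeze (x y z t : nat) : (x <= z -> y <= t -> z + t <= x + y ->
    z <= x /\ t <= y)%N by lia.
  by have [le' le] := squeeze _ _ _ _ r1' r1 rK; split; [exact: r2' | exact: r2].
(* Together with the support projections of [K'] and [K], the absorbed parts form a unital self-map
   of [Lt] whose members all end in those supports; minimality then makes the supports full. *)
pose Q' k := if k is Some x then K'^t* *m (P x *m (1%:M - K'^t* *m K')) else K'^t* *m K'.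
pose Q k := if k is Some x then K^t* *m (W x *m (1%:M - K^t* *m K)) else K^t* *m K.
have gramQ' : \sum_k (Q' k)^t* *m Q' k = 1%:M.
  rewrite sum_option /= (partial_isometry_gram KE' PP) => [|k]; last by have [] := absorbed k.
  by rewrite adjmxM trmxCK pK' addrCA subrr addr0.
have gramQ : \sum_k (Q k)^t* *m Q k = 1%:M.
  rewrite sum_option /= (partial_isometry_gram KE WW) => [|k]; last by have [] := absorbed k.
  by rewrite adjmxM trmxCK pK addrCA subrr addr0.
have LQ k : intertwines Lt Lt (Q' k) (Q k).
  case: k => [k|] //=; apply: intertwines_comp (intertwines_adj LK) _.
  exact: intertwines_comp (PW k) LD.
have kQ : kraus_map Q' Q Lt Lt.
  move=> j; rewrite -[RHS]mul1mx -gramQ' mulmx_suml; apply: eq_bigr => k _.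
  by have [e _] := LQ k j; rewrite -!mulmxA e.
have [||||||||E1' E1] := @minimal_compression R g p' p Lt g0 Lmin _ Q' Q
  (K'^t* *m K') (K^t* *m K) kQ.
- exact: subunital_of_gram.
- exact: subunital_of_gram.
- by rewrite adjmxM trmxCK.
- exact: pK'.
- by rewrite adjmxM trmxCK.
- exact: pK.
- have EK : K'^t* *m K' *m K'^t* = K'^t*.
    by have /(congr1 (fun M => M^t*)) /= := KE'; rewrite !adjmxM trmxCK.
  by case=> [k|] /=; rewrite ?pK' // mulmxA EK.
- have EK : K^t* *m K *m K^t* = K^t*.
    by have /(congr1 (fun M => M^t*)) /= := KE; rewrite !adjmxM trmxCK.
  by case=> [k|] /=; rewrite ?pK // mulmxA EK.
by exists K', K.
Qed.

End Minimal.

(** [V] is an orthonormal basis of the complement of the range. Both [row_mx K V] and its adjoint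
    are isometries, which forces the sizes to add up. *)
Lemma isometry_completion m n (K : 'M[C]_(m, n)) : K^t* *m K = 1%:M ->
  exists (k : nat) (V : 'M[C]_(m, k)),
  [/\ (n + k)%N = m, V^t* *m K = 0, row_mx K V *m (row_mx K V)^t* = 1%:M
    & (row_mx K V)^t* *m row_mx K V = 1%:M].
Proof.
move=> KK; have [||k [V [VV VE]]] := @proj_factor R _ (1%:M - K *m K^t*).
- by rewrite adjmxB adjmx1 adjmxM trmxCK.
- rewrite mulmxBl mul1mx mulmxBr mulmx1 -mulmxA (mulmxA (K^t*)) KK mul1mx.
  by rewrite subrr subr0.
have VK : V^t* *m K = 0.
  rewrite -[V^t*]mul1mx -VV -!mulmxA (mulmxA V) VE mulmxBl mul1mx -mulmxA KK mulmx1.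
  by rewrite subrr mulmx0.
have KV : K^t* *m V = 0 by rewrite -[LHS]trmxCK adjmxM trmxCK VK adjmx0.
have u1 : row_mx K V *m (row_mx K V)^t* = 1%:M.
  by rewrite adjmx_row mul_row_col VE addrCA subrr addr0.
have u2 : (row_mx K V)^t* *m row_mx K V = 1%:M.
  by rewrite adjmx_row mul_col_row KK KV VK VV -scalar_mx_block.
exists k, V; split => //; apply/eqP; rewrite eqn_leq (isometry_dim u2) /=.
by apply: (@isometry_dim R _ _ ((row_mx K V)^t*)); rewrite trmxCK.
Qed.

End Embedding.

(** * The direct sum decomposition *)

Section DirectSum.
Variable R : realType.
Local Notation C := R[i].

Lemma unitary_pencil_cast g m' m d' d (e' : m' = d') (e : m = d)
    (L : pencil R g d' d) (D : pencil R g m' m)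
    (Q0 : 'M[C]_(d', m')) (G0 : 'M[C]_(d, m)) :
  Q0 *m Q0^t* = 1%:M -> G0 *m G0^t* = 1%:M ->
  (forall j, L j = Q0 *m D j *m G0^t*) ->
  exists (Q : 'M[C]_d') (G : 'M[C]_d),
    [/\ Q \is unitarymx, G \is unitarymx &
      forall j, L j = Q *m pencil_cast (e', e) D j *m G^t*].
Proof.
subst d' d => QQ GG LE; exists Q0, G0; split; [exact/unitarymxP|exact/unitarymxP|].
by move=> j; rewrite /pencil_cast castmx_id.
Qed.

(** The ranges of [K'] and [K] reduce [L]: each half of [intertwines] kills one off-diagonal block,
    and [J] is the compression to the complements. *)
Lemma dsum_of_isometries g d' d p' p (L : pencil R g d' d) (N : pencil R g p' p) K' K :
  intertwines L N K' K -> K'^t* *m K' = 1%:M -> K^t* *m K = 1%:M ->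
  exists (k' k : nat) (e' : (p' + k' = d')%N) (e : (p + k = d)%N)
      (J : pencil R g k' k) (Q : 'M[C]_d') (G : 'M[C]_d),
    [/\ Q \is unitarymx, G \is unitarymx &
      forall j : 'I_g,
        L j = Q *m pencil_cast (e', e) (pencil_dsum N J) j *m G ^t*].
Proof.
move=> LN KK' KK.
have [k' [V' [e' VK' u' _]]] := isometry_completion KK'.
have [k [V [e VK u _]]] := isometry_completion KK.
pose J : pencil R g k' k := fun j => V'^t* *m L j *m V.
have [|Q [G QG]] := @unitary_pencil_cast g _ _ _ _ e' e L (pencil_dsum N J) _ _ u' u.
  move=> j; have [l1 l2] := LN j.
  have KLV : K'^t* *m L j *m V = 0.
    have <- : ((L j)^t* *m K')^t* = K'^t* *m L j by rewrite adjmxM trmxCK.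
    rewrite l2 adjmxM trmxCK -mulmxA -[K^t* *m V]trmxCK adjmxM trmxCK VK.
    by rewrite adjmx0 mulmx0.
  have -> : pencil_dsum N J j = (row_mx K' V')^t* *m L j *m row_mx K V.
    rewrite adjmx_row mul_col_mx mul_col_row KLV /pencil_dsum /J.
    by rewrite -!(mulmxA _ (L j) K) l1 !mulmxA KK' VK' mul1mx mul0mx.
  by rewrite -!mulmxA u mulmx1 mulmxA u' mul1mx.
by exists k', k, e', e, J, Q, G.
Qed.

(** Without variables all balls coincide and every pencil is nondegenerate, so a [1 x 1] pencil
    competes. *)
Lemma min_dim_pencil_g0 p' p (N : pencil R 0 p' p) :
  min_dim_pencil N -> (p' * p <= 1)%N.
Proof.
move=> [_ Nmin]; rewrite -[1%N]muln1.
have pact0 a' a m n (M : pencil R 0 a' a) (X : 'I_0 -> 'M[C]_(m, n)) W : pact M X W = 0.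
  by rewrite /pact big_ord0.
apply: (Nmin _ _ (fun=> 0 : 'M[C]_1)) => // [n X _ []//|].
by apply: bounded_same_ball => n X c c0; split=> _ W; rewrite pact0 fro20 mulr_ge0 // fro2_ge0.
Qed.

End DirectSum.

Theorem lemma1p2 (R : realType) (g d' d p' p : nat)
    (hd' : (0 < d')%N) (hd : (0 < d)%N) (hp' : (0 < p')%N) (hp : (0 < p)%N)
    (L : pencil R g d' d) (Lt : pencil R g p' p) :
  nondegenerate_pencil L ->
  min_dim_defining_pencil Lt L ->
  exists (k' k : nat) (e' : (p' + k' = d')%N) (e : (p + k = d)%N)
      (J : pencil R g k' k) (Q : 'M[R[i]]_d') (G : 'M[R[i]]_d),
    [/\ Q \is unitarymx, G \is unitarymx &
      forall j : 'I_g,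
        L j = Q *m pencil_cast (e', e) (pencil_dsum Lt J) j *m G ^t*].
Proof.
move=> _ [Lmin LtL]; have [g0|g0] := posnP g; last first.
  have [K' [K [LK KK' KK]]] := isometric_intertwiner g0 Lmin LtL.
  exact: dsum_of_isometries LK KK' KK.
subst g; have pp := min_dim_pencil_g0 Lmin.
(* Positive sizes with product at most one are both [1]; the identity to prove is indexed by ['I_0],
   so any [J] of the remaining size serves. *)
have [e' e] : (p' + d'.-1 = d')%N /\ (p + d.-1 = d)%N by nia.
exists d'.-1, d.-1, e', e, (fun=> 0), 1%:M, 1%:M.
by split; [apply/unitarymxP; rewrite adjmx1 mul1mx..|case].
Qed.
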